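(* Let $d\ge2$, $R\ge1$ and $n\ge2$ be integers/reals as indicated, let $C\subseteq\mathbb{R}^d$ be a bounded $R$-fat Borel set, let $m:=\lceil n^{1/d}\rceil$ (the smallest integer with $n\le m^d$), and let $S$ be the family of all $mR$-fat Borel subsets of $\mathbb{R}^d$. Then $\mathrm{PropEF}(C,n,S)=1/n$.
   Context: For $R\ge1$, a $d$-dimensional piece (Borel subset of $\mathbb{R}^d$) is $R$-fat if it contains a $d$-dimensional cube $B^-$ and is contained in a $d$-dimensional cube $B^+$ parallel to $B^-$ with $\mathrm{len}(B^+)/\mathrm{len}(B^-)\le R$ (len = side length). A value measure on $C$ is $V(X)=\int_X v$ with $v$ non-negative, bounded, integrable on $C$, $V(C)<\infty$; $V^S(X):=\sup\{V(s):s\in S,s\subseteq X\}$. For $n$ agents with value measures $V_1,\dots,V_n$, an $S$-allocation is $(X_1,\dots,X_n)$ with $X_i\in S$ pairwise disjoint and $\bigcup_i X_i\subseteq C$; it is envy-free if $V_i^S(X_i)\ge V_i^S(X_j)$ for all $i,j$. $\mathrm{PropEF}(C,n,S):=\inf_{V_1,\dots,V_n}\sup_X\min_i V_i(X_i)/V_i(C)$, the infimum over all $n$-tuples of value measures on $C$ and the supremum over envy-free $S$-allocations. *)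

(* Defs.v *)
(* Points of R^d are d.-tuples of reals, equipped with
   the library's product sigma-algebra on tuples (= Borel sets of R^d). *)
From HB Require Import structures.
From mathcomp Require Import all_boot all_order all_algebra.
From mathcomp Require Import all_classical all_reals all_analysis.
Set Implicit Arguments. Unset Strict Implicit. Unset Printing Implicit Defensive.
Import Order.TTheory GRing.Theory Num.Theory.
Local Open Scope classical_set_scope.
Local Open Scope ring_scope.

Section Defs.
Variable R : realType.

(* d-dimensional Lebesgue integral of a function R^d -> \bar R, written as the
   iterated one-dimensional Lebesgue integral (equal to the integral w.r.t.
   d-dimensional Lebesgue measure for non-negative measurable integrands,
   by Tonelli). *)
Fixpoint iint (d : nat) : (d.-tuple R -> \bar R) -> \bar R :=
  match d return (d.-tuple R -> \bar R) -> \bar R with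
  | 0 => fun f => f [tuple]
  | d'.+1 => fun f =>
      (\int[@lebesgue_measure R]_x iint (fun t : d'.-tuple R => f [tuple of x :: t]))%E
  end.

Definition orthogonal_mx d (Q : 'M[R]_d) := Q *m Q^T = 1%:M.

Definition cube d (Q : 'M[R]_d) (c : d.-tuple R) (l : R) : set (d.-tuple R) :=
  [set x | forall i : 'I_d,
     0 <= \sum_(j < d) Q i j * (tnth x j - tnth c j) <= l].

Definition fat d (rho : R) (X : set (d.-tuple R)) :=
  exists (Q : 'M[R]_d) (c1 c2 : d.-tuple R) (l1 l2 : R),
    [/\ orthogonal_mx Q, 0 < l1, cube Q c1 l1 `<=` X, X `<=` cube Q c2 l2
      & l2 <= rho * l1].

Definition fat_family d (rho : R) : set (set (d.-tuple R)) :=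
  [set X | measurable X /\ fat rho X].

Definition bounded_piece d (C : set (d.-tuple R)) :=
  exists M : R, forall x, C x -> forall i : 'I_d, `|tnth x i| <= M.

Definition Vval d (v : d.-tuple R -> R) (X : set (d.-tuple R)) : \bar R :=
  iint (fun x => ((\1_X x : R) * v x)%:E).

Definition value_density d (C : set (d.-tuple R)) (v : d.-tuple R -> R) :=
  [/\ measurable_fun setT v, (forall x, 0 <= v x),
      (exists M : R, forall x, v x <= M),
      (Vval v C < +oo)%E & (0 < Vval v C)%E].

Definition VS d (S : set (set (d.-tuple R))) (v : d.-tuple R -> R)
    (X : set (d.-tuple R)) : \bar R :=
  ereal_sup [set Vval v s | s in [set s | S s /\ s `<=` X]].

Definition S_allocation d n (C : set (d.-tuple R)) (S : set (set (d.-tuple R)))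
    (X : 'I_n -> set (d.-tuple R)) :=
  [/\ forall i, S (X i),
      (forall i j, i != j -> X i `&` X j = set0)
    & forall i, X i `<=` C].

Definition envy_free d n (S : set (set (d.-tuple R)))
    (v : 'I_n -> d.-tuple R -> R) (X : 'I_n -> set (d.-tuple R)) :=
  forall i j, (VS S (v i) (X j) <= VS S (v i) (X i))%E.

Definition min_prop d n (C : set (d.-tuple R)) (v : 'I_n -> d.-tuple R -> R)
    (X : 'I_n -> set (d.-tuple R)) : \bar R :=
  \big[Order.min/+oo%E]_(i < n)
     ((fine (Vval (v i) (X i)) / fine (Vval (v i) C))%:E).

Definition PropEF d (C : set (d.-tuple R)) (n : nat)
    (S : set (set (d.-tuple R))) : \bar R :=
  ereal_inf [set ereal_sup [set min_prop C v X | X in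
                   [set X | S_allocation C S X /\ envy_free S v X]]
            | v in [set v : 'I_n -> d.-tuple R -> R |
                      forall i, value_density C (v i)]].

End Defs.

(* Main.v *)
(* A piece that contains a cube of side [a] and fits into a cube of side
   [m * rho * a] is automatically in [S], whatever its shape.  Cut the inner cube
   of the cake into m^d >= n cells and attach to each point t of the standard
   simplex a partition of (almost all of) the cake: piece j is a shrunken copy of
   cell j while t_j is small, and cell j plus a share of the remainder once t_j is
   large.  All pieces with t_j > 0 are then fat, the piece
   with t_j = 0 is null, and values depend continuously on t, so the
   Gale / Simmons-Su theorem, obtained here from Sperner's lemma on a triangulation
   whose vertices are owned by the agents, gives an envy-free division.  Closed
   cells touch, so they are first scaled by a factor delta < 1, and the trimmed part
   of the cake disappears as delta tends to 1.  Conversely, if all agents value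
   volume, no allocation can give everyone more than 1/n. *)
Require Import Defs.
From HB Require Import structures.
From mathcomp Require Import all_boot all_order all_algebra all_fingroup.
From mathcomp Require Import all_classical all_reals all_analysis.
From mathcomp Require Import measurable_realfun.
From mathcomp Require Import zify ring lra.
Set Implicit Arguments. Unset Strict Implicit. Unset Printing Implicit Defensive.
Import Order.TTheory GRing.Theory Num.Theory.
Import numFieldNormedType.Exports.
Local Open Scope ring_scope.

(** * Sperner's lemma *)

(** Envy-freeness is stated for [VS], but every piece handed out lies in [S]: an agent's own piece
    has [VS] equal to [Vval], and [VS] of another piece is at most its [Vval], so plain values may
    be compared. The equilibrium theorem requires that an empty piece is never a favourite: a piece
    with t_j = 0 is null, while the pieces cover the trimmed cake, whose value is positive, so some
    piece is strictly better. The same covering yields the proportion: a favourite among n pieces is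
    worth at least 1/n of the trimmed cake. Two obstacles come from the iterated integral [iint].
    Continuity in t rests on dominated convergence, so [iint] is realised as integration against a
    sigma-finite measure. And the cubes may be rotated, but rotation invariance of volume is
    avoided: slicing shows that every hyperplane is null, which disposes of all boundaries and level
    sets, and a small axis-parallel box inside the rotated cube gives positive volume. *)

Lemma odd_card_involution (T : finType) (A : {set T}) (f : T -> T) :
  (forall x, x \in A -> f x \in A) -> (forall x, x \in A -> f (f x) = x) ->
  odd #|A| = odd #|[set x in A | f x == x]|.
Proof.
have [k] := ubnP #|A|; elim: k A => // k IH A ltA fA ffA.
have [B0|[x]] := set_0Vmem [set x in A | f x != x].
  congr (odd _); apply: eq_card => x; rewrite inE.
  case Ax: (x \in A) => //=; have := finset.in_set0 x.
  by rewrite -B0 inE Ax /= => /negbT; rewrite negbK => ->.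
rewrite inE => /andP[Ax fx].
pose B := A :\ x :\ f x.
have fxA : f x \in A :\ x by rewrite !inE fx fA.
have cA : #|A| = #|B|.+2.
  by rewrite (cardsD1 x A) Ax (cardsD1 (f x) (A :\ x)) fxA.
have inj y : y \in A -> f y = f x -> y = x by move=> Ay e; rewrite -(ffA y) // e ffA.
rewrite cA /= negbK IH.
- congr (odd _); apply: eq_card => y; rewrite !inE.
  case: (y =P x) => [->|yx] /=; first by rewrite (negbTE fx) !andbF.
  case: (y =P f x) => [->|//] /=.
  by rewrite (ffA x) // eq_sym (negbTE fx) !andbF.
- by move: ltA; rewrite cA; lia.
- move=> y; rewrite !inE => /and3P[yfx yx Ay]; rewrite fA // andbT.
  apply/andP; split; apply/eqP.
    by move=> /(inj _ Ay) e; rewrite e eqxx in yx.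
  by move=> e; move: yfx; rewrite -e ffA // eqxx.
- by move=> y; rewrite !inE => /and3P[_ _ Ay]; exact: ffA.
Qed.

Section Sperner.
Variables p N : nat.
Local Notation idx := 'I_p.+2.
Local Notation vertex := {ffun idx -> 'I_N.+1}.
Local Notation array := {ffun idx -> vertex}.
Local Notation last := (ord_max : idx).
Local Open Scope nat_scope.

(* Each step of a simplex adds 1 to the owner, so every simplex has exactly one
   vertex owned by each agent. *)
Definition owner (x : vertex) : idx := (\sum_(a : idx) a *+ x a)%R.

Definition delta (b a : idx) : nat := (a == b).

Definition step (x : vertex) (b : idx) (y : vertex) :=
  [forall a : idx, y a + (a == b) == x a + (a == (b + 1)%R)].

Definition mass (x : vertex) := \sum_a (x a : nat).

(* Freudenthal triangulation of {x : sum x = N}: a simplex is a closed walk that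
   moves one unit from coordinate b to coordinate b + 1 (cyclically) for each b once;
   the owner condition fixes which vertex is s 0. *)
Definition simplex (s : array) :=
  [&& [exists pi : {perm idx}, forall k, step (s k) (pi k) (s (k + 1)%R)],
      [forall k, mass (s k) == N] & [forall k, owner (s k) == k]].

Lemma stepP (x : vertex) (b : idx) (y : vertex) : reflect (forall a : idx, y a + delta b a = x a + delta (b + 1)%R a)
  (step x b y).
Proof. exact: 'forall_eqP. Qed.

Lemma succ_neq (b : idx) : (b == (b + 1)%R) = false.
Proof. by apply/eqP => /esym/eqP; rewrite -subr_eq0 addrAC subrr add0r oner_eq0. Qed.

Lemma step_mass x b y : step x b y -> mass y = mass x.
Proof.
move=> /stepP sxy; have : \sum_a (y a + (a == b)) = \sum_a (x a + (a == (b+1)%R)).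
  by apply: eq_bigr => a _; rewrite sxy.
have one (c : idx) : \sum_a (a == c : nat) = 1.
  by rewrite (bigD1 c) //= eqxx big1 // => a /negbTE ->.
by rewrite !big_split /= !one => /addIn.
Qed.

Lemma step_owner x b y : step x b y -> owner y = (owner x + 1)%R.
Proof.
move=> /stepP sxy.
have : (\sum_(a : idx) a *+ (y a + (a == b)) = \sum_(a : idx) a *+ (x a + (a == (b+1)%R)))%R.
  by apply: eq_bigr => a _; rewrite sxy.
have one (c : idx) : (\sum_(a : idx) a *+ (a == c : nat) = c)%R.
  by rewrite (bigD1 c) //= eqxx big1 ?addr0 // => a /negbTE ->.
under eq_bigr do rewrite mulrnDr; under [in RHS]eq_bigr do rewrite mulrnDr.
by rewrite !big_split /= !one addrCA addrC => /addrI; rewrite addrC.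
Qed.

Lemma simplexP s : simplex s ->
  exists2 pi : {perm idx}, (forall k, step (s k) (pi k) (s (k + 1)%R)) &
    (forall k, mass (s k) = N) /\ (forall k, owner (s k) = k).
Proof.
case/and3P => /existsP[pi /forallP sp] /'forall_eqP m /'forall_eqP o.
by exists pi.
Qed.

Definition shift (k : idx) (r : nat) : idx := (k + r%:R)%R.

Lemma shift0 k : shift k 0 = k.
Proof. exact: addr0. Qed.

Lemma shiftS k r : shift k r.+1 = (shift k r + 1)%R.
Proof. by rewrite /shift -addrA natr1. Qed.

Lemma shiftP (k i : idx) : exists2 r, r < p.+2 & i = shift k r.
Proof.
by exists (i - k)%R; [exact: ltn_ord | rewrite /shift natr_Zp addrCA subrr addr0].
Qed.

Lemma shift_inj k r r' : r < p.+2 -> r' < p.+2 -> shift k r = shift k r' -> r = r'.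
Proof.
move=> lr lr' /addrI /(congr1 val).
by rewrite !Zp_nat /= !modn_small.
Qed.

(** A step preserves the mass and adds 1 to the owner, so both conditions spread from one vertex
    around the cycle. *)
Lemma simplex_chain (s : array) (pi : {perm idx}) (i0 : idx) :
  (forall k, step (s k) (pi k) (s (k + 1)%R)) ->
  mass (s i0) = N -> owner (s i0) = i0 -> simplex s.
Proof.
move=> sp m0 o0.
have chain i : mass (s i) = N /\ owner (s i) = i.
  have [r _ ->] := shiftP i0 i; elim: r => [|r [IHm IHo]]; first by rewrite shift0.
  by rewrite shiftS (step_mass (sp _)) (step_owner (sp _)) IHm IHo.
apply/and3P; split; first by apply/existsP; exists pi; apply/forallP.
  by apply/'forall_eqP => i; case: (chain i).
by apply/'forall_eqP => i; case: (chain i).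
Qed.

Lemma sum_injective (f : idx -> idx) (a : idx) : injective f -> \sum_q delta (f q) a <= 1.
Proof.
rewrite /delta => fI; have [/existsP[q /eqP ->]|/existsPn nf] := boolP [exists q, a == f q].
  rewrite (bigD1 q) //= eqxx big1 // => r rq.
  by apply/eqP; rewrite eqb0; apply: contra rq => /eqP/fI ->.
by rewrite big1 // => q _; rewrite (negbTE (nf q)).
Qed.

(** The walk from [k] to [i] uses each move at most once, and only one move adds a unit to
    coordinate [a]. *)
Lemma simplex_close s i k a : simplex s -> s i a <= s k a + 1.
Proof.
case/simplexP => pi sp _; have [r ltr ->] := shiftP k i.
have fI : injective (fun q => pi q + 1)%R by move=> q q' /addIr/perm_inj.
have: s (shift k r) a <= s k a + \sum_(0 <= j < r) delta (pi (shift k j) + 1)%R a.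
  elim: r {ltr} => [|r IH]; first by rewrite shift0 leq_addr.
  rewrite big_nat_recr //= shiftS.
  by have /stepP/(_ a) := sp (shift k r); lia.
move=> /leq_trans; apply; rewrite leq_add2l.
apply: leq_trans (sum_injective a fI).
rewrite [leqRHS](reindex_inj (addrI k)) /=.
apply: (@leq_trans (\sum_(0 <= j < p.+2) delta (pi (shift k j) + 1)%R a)).
  rewrite [leqRHS](big_cat_nat (n := r)); [exact: leq_addr | exact: leq0n | exact: ltnW].
by rewrite big_mkord; apply: eq_leq; apply: eq_bigr => j _; rewrite /shift natr_Zp.
Qed.

(** The reflected vertex s (k - 1) + s (k + 1) - s k has no negative coordinate; this is also what
    keeps the subtraction on [nat] from truncating. *)
Definition flippable (s : array) k := [forall a, s k a <= s (k - 1)%R a + s (k + 1)%R a].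

(* The simplex on the other side of the facet opposite to vertex k; a facet in the
   boundary is not flippable and leaves s fixed. *)
Definition flip (s : array) k : array :=
  if flippable s k then
    [ffun i => if i == k then [ffun a => inord (s (k - 1)%R a + s (k + 1)%R a - s k a)]
               else s i]
  else s.

Lemma flip_other s k i : i != k -> flip s k i = s i.
Proof. by rewrite /flip; case: ifP => // _ /negbTE ik; rewrite ffunE ik. Qed.

Lemma pred_neq (b : idx) : ((b - 1)%R == b) = false.
Proof. by have := succ_neq (b - 1)%R; rewrite subrK. Qed.

Lemma flip_add s k a : simplex s -> flippable s k ->
  flip s k k a + s k a = s (k - 1)%R a + s (k + 1)%R a.
Proof.
move=> /simplexP[pi _ [ms _]] fk; have /forallP le := fk.
rewrite /flip fk ffunE eqxx ffunE inordK ?subnK ?le // ltnS.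
have : \sum_b (s (k - 1)%R b + s (k + 1)%R b - s k b) = N.
  have eN i : \sum_b (s i b : nat) = N := ms i.
  by rewrite sumnB // big_split /= !eN addnK.
by move=> /eq_leq; apply: leq_trans; rewrite (bigD1 a) //= leq_addr.
Qed.

(** Reflecting vertex [k] exchanges the moves into and out of it, whence the transposition in front
    of [pi]. *)
Lemma flip_simplex s k : simplex s -> simplex (flip s k).
Proof.
move=> ss; have [fk|nfk] := boolP (flippable s k); last by rewrite /flip (negbTE nfk).
have [pi sp [ms os]] := simplexP ss.
have k1 : (k - 1 != k)%R by rewrite pred_neq.
apply: (@simplex_chain _ (tperm (k - 1)%R k * pi)%g (k - 1)%R); last 2 first.
- by rewrite flip_other.
- by rewrite flip_other.
have st1 : forall a, s k a + delta (pi (k - 1)%R) a = s (k - 1)%R a + delta (pi (k - 1) + 1)%R a.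
  by move=> a; have /stepP/(_ a) := sp (k - 1)%R; rewrite subrK.
move=> q; apply/stepP => a; rewrite permM.
have fa := flip_add a ss fk.
have /stepP/(_ a) st := sp k; have sa := st1 a.
have [->|q1] := eqVneq q (k - 1)%R.
  by rewrite tpermL subrK (flip_other _ k1); lia.
have [->|qk] := eqVneq q k.
  by rewrite tpermR flip_other ?(eq_sym _ k) ?succ_neq //; lia.
rewrite tpermD 1?eq_sym // !flip_other //; first by have /stepP := sp q.
by apply: contra q1 => /eqP <-; rewrite addrK.
Qed.

Lemma flipK s k : simplex s -> flip (flip s k) k = s.
Proof.
move=> ss; have [fk|nfk] := boolP (flippable s k); last first.
  by rewrite {2}/flip (negbTE nfk) /flip (negbTE nfk).
have k1 : (k - 1 != k)%R by rewrite pred_neq.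
have k2 : (k + 1 != k)%R by rewrite eq_sym succ_neq.
have fk' : flippable (flip s k) k.
  by apply/forallP => a; rewrite !(flip_other _ k1, flip_other _ k2) -(flip_add a ss fk) leq_addr.
apply/ffunP => i; have [->|ik] := eqVneq i k; last by rewrite !flip_other.
apply/ffunP => a; apply: val_inj => /=.
have := flip_add a (flip_simplex k ss) fk'; rewrite !(flip_other _ k1, flip_other _ k2).
by have := flip_add a ss fk; lia.
Qed.

(** A fixed vertex would make the moves into and out of [k] equal; coordinate [pi k] separates them,
    as the move out lowers it and the move in does not. *)
Lemma flip_neq s k : simplex s -> flippable s k -> flip s k != s.
Proof.
move=> ss fk; apply/eqP => e; have [pi sp _] := simplexP ss.
have := flip_add (pi k) ss fk; rewrite e.
have /stepP/(_ (pi k)) := sp (k - 1)%R; have /stepP/(_ (pi k)) := sp k.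
rewrite subrK /delta eqxx succ_neq (inj_eq perm_inj) (eq_sym k) pred_neq /=.
lia.
Qed.

Variable lab : vertex -> idx.
Hypothesis lab_gt0 : forall x, mass x = N -> 0 < x (lab x).

(** The facet opposite to vertex [k] has as many vertices as there are labels other than [last], so
    a door carries each of these exactly once. *)
Definition door (c : idx -> idx) k :=
  [forall j, (j != last) ==> [exists i, (i != k) && (c i == j)]].

Lemma doorP c k : reflect (forall j, j != last -> exists2 i, i != k & c i = j) (door c k).
Proof.
apply: (iffP forallP) => h j; first by move=> jl; have := h j; rewrite jl => /existsP[i /andP[ik /eqP]]; exists i.
by apply/implyP => /h[i ik ci]; apply/existsP; exists i; rewrite ik ci eqxx.
Qed.

(** If there is a door, opposite to [k0], the lack of injectivity forces the label of [k0] to repeat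
    that of a unique [k1]; the doors are then exactly the facets opposite to [k0] and [k1]. *)
Lemma even_doors c : ~ injective c -> odd #|[set k | door c k]| = false.
Proof.
move=> nI; have [->|[k0]] := set_0Vmem [set k | door c k]; first by rewrite cards0.
rewrite inE => d0; have /doorP D0 := d0.
have sub : [set~ last] \subset c @: [set~ k0].
  apply/fintype.subsetP => j; rewrite !inE => /D0[i ik <-]; apply: imset_f.
  by rewrite !inE.
have cI : {in [set~ k0] &, injective c}.
  apply/imset_injP; rewrite eqn_leq leq_imset_card /=.
  by apply: leq_trans (subset_leq_card sub); rewrite !cardsC1.
have im : c @: [set~ k0] = [set~ last].
  apply/esym/eqP; rewrite eqEcard sub /=.
  by apply: leq_trans (leq_imset_card _ _) _; rewrite !cardsC1.
have ck i : i != k0 -> c i != last.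
  by move=> ik; have : c i \in c @: [set~ k0] by [rewrite imset_f ?inE]; rewrite im !inE.
have c0 : c k0 != last.
  apply/eqP => c0; apply: nI => i j; have [->|ik] := eqVneq i k0.
    by have [->//|jk] := eqVneq j k0; rewrite c0 => e; have := ck _ jk; rewrite -e eqxx.
  have [->|jk] := eqVneq j k0; first by rewrite c0 => e; have := ck _ ik; rewrite e eqxx.
  by apply: cI; rewrite inE inE.
have [k1 k10 ck1] := D0 _ c0.
rewrite (_ : [set k | door c k] = [set k0; k1]); first by rewrite cards2 eq_sym k10.
apply/finset.setP => k; rewrite !inE; apply/idP/idP => [/doorP D|/orP[] /eqP -> //].
  have [//|kk0] := eqVneq k k0; have [i ik ci] := D _ (ck _ kk0).
  apply/eqP/(cI k k1); rewrite ?inE //.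
  have [e|ik0] := eqVneq i k0; first by rewrite ck1 -ci e.
  by move: ik; rewrite (cI i k _ _ ci) ?inE ?eqxx.
apply/doorP => j /D0[i ik ci]; have [e|] := eqVneq i k1; last by exists i.
by exists k0; rewrite 1?eq_sym // -ck1 -e.
Qed.

Hypothesis N_gt0 : 0 < N.
(* This labelling of one face leaves a single boundary door, the one at [corner],
   so no induction on the dimension is needed. *)
Hypothesis lab_face : forall x, mass x = N -> x last = 0 :> nat ->
  forall j : idx, (j < lab x)%N -> x j = 0 :> nat.

(** * The corner simplex and the boundary doors *)

Let q0 : idx := inord p.
Let i0 : idx := (q0 *+ N)%R.

Let last_succ : (last + 1 = 0)%R.
Proof. by apply: val_inj; rewrite /= -[X in (_ + X)%N]/1%N addn1 modnn. Qed.

Let val_q0 : q0 = p :> nat.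
Proof. by rewrite inordK. Qed.

Let q0S : (q0 + 1)%R = last.
Proof.
by apply: val_inj; rewrite /= val_q0 -[X in (_ + X)%N]/1%N addn1 modn_small.
Qed.

Let q0_neq : (q0 == last) = false.
Proof. by rewrite -q0S succ_neq. Qed.

(** With e_b the unit vectors, vertex [q] is (N - 1) e_q0 + e_b for b = q0 + (q - i0), where [q0] is
    the largest label other than [last]. Since [i0] is the owner of N e_q0, that point is vertex
    [i0]. *)
Definition corner : array := [ffun q =>
  [ffun a => inord (N * delta q0 a + delta (q0 + (q - i0))%R a - delta q0 a)]].

Lemma cornerE q a : corner q a + delta q0 a = N * delta q0 a + delta (q0 + (q - i0))%R a.
Proof.
rewrite !ffunE; have : delta q0 a <= 1 by exact: leq_b1.
have : delta (q0 + (q - i0))%R a <= 1 by exact: leq_b1.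
move: (delta (q0 + (q - i0))%R a) => d1.
case: (delta q0 a) => [|[|d0]] l1 l0 //.
  by rewrite muln0 subn0 addn0 inordK // ltnS; lia.
by rewrite muln1 inordK ?ltnS; lia.
Qed.

Lemma corner_simplex : simplex corner.
Proof.
have piI : injective (fun q : idx => q0 + (q - i0))%R by move=> q q' /addrI /addIr.
apply: (@simplex_chain _ (perm piI) i0).
- move=> k; apply/stepP => a; rewrite permE.
  have := cornerE k a; have := cornerE (k + 1)%R a.
  rewrite (_ : q0 + (k + 1 - i0) = q0 + (k - i0) + 1)%R; first by lia.
  by rewrite addrAC addrA.
- rewrite /mass (bigD1 q0) //= big1 => [|a aq].
    by have := cornerE i0 q0; rewrite subrr addr0 /delta eqxx; lia.
  by have := cornerE i0 a; rewrite subrr addr0 /delta (negbTE aq); lia.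
- rewrite /owner (bigD1 q0) //= big1 => [|a aq].
    have := cornerE i0 q0; rewrite subrr addr0 /delta eqxx muln1 => /addIn ->.
    by rewrite addr0.
  have := cornerE i0 a; rewrite subrr addr0 /delta (negbTE aq) muln0 !addn0 => ->.
  exact: mulr0n.
Qed.

(** At N e_q0 only coordinate [q0] can give up a unit; afterwards [q0] has had its turn, so only the
    unit just moved can go on. The walk is forced. *)
Lemma corner_uniq s i : simplex s -> s i q0 = N :> nat ->
  (forall a, a != q0 -> s i a = 0 :> nat) -> i = i0 /\ s = corner.
Proof.
move=> ss sq sn; have [pi sp [ms os]] := simplexP ss.
have ii : i = i0.
  rewrite -(os i) /owner (bigD1 q0) //= big1 => [|a aq].
    by rewrite sq addr0.
  by rewrite (sn a aq) mulr0n.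
split=> //.
have main r : r < p.+2 ->
    (forall a, s (shift i r) a + delta q0 a = N * delta q0 a + delta (shift q0 r) a) /\
    (forall j, j < r -> pi (shift i j) = shift q0 j).
  elim: r => [_|r IH ltr].
    split=> // a; rewrite !shift0 /delta; have [->|aq] := eqVneq a q0; first by rewrite sq muln1.
    by rewrite (sn a aq) muln0.
  have [IHs IHp] := IH (ltnW ltr).
  have st a : s (shift i r.+1) a + delta (pi (shift i r)) a =
      s (shift i r) a + delta (pi (shift i r) + 1)%R a.
    by rewrite shiftS; have /stepP := sp (shift i r).
  have pir : pi (shift i r) = shift q0 r.
    apply/eqP; apply: contraT => ne.
    have := st (pi (shift i r)); have := IHs (pi (shift i r)).
    rewrite /delta succ_neq eqxx (negbTE ne).
    have [e|_] := eqVneq (pi (shift i r)) q0; last by lia.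
    have r0 : (0 < r)%N by case: (r) e ne => // e; rewrite e shift0 eqxx.
    have := IHp 0 r0; rewrite !shift0 -e => /perm_inj; rewrite -{1}(shift0 i).
    by move=> /shift_inj h; move: r0; rewrite -h // ltnW.
  split=> [a|j].
    by have := st a; have := IHs a; rewrite pir -shiftS; lia.
  by rewrite ltnS leq_eqVlt => /orP[/eqP ->//|/IHp].
apply/ffunP => q; apply/ffunP => a; apply: val_inj => /=.
have [r ltr ->] := shiftP i q; have [/(_ a) e _] := main r ltr.
by have := cornerE (shift i r) a; rewrite {2}/shift -ii [(i + _)%R]addrC addrK -/(shift q0 r); lia.
Qed.

(** Pairs of a simplex and one of its doors are counted. Without a fully labelled simplex each
    simplex has an even number of doors; but flipping across the door is an involution on the pairs
    whose only fixed point is the boundary door at [corner], so their number is odd. *)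
Lemma sperner : exists2 s, simplex s & injective (lab \o s).
Proof.
apply: contrapT => none.
pose P := [set q : array * idx | simplex q.1 & door (lab \o q.1) q.2].
pose f (q : array * idx) := (flip q.1 q.2, q.2).
have ev : odd #|P| = false.
  rewrite -sum1_card (eq_bigl (fun q => simplex q.1 && door (lab \o q.1) q.2)); last first.
    by move=> q; rewrite inE.
  rewrite -(pair_big_dep simplex (fun s k => door (lab \o s) k) (fun _ _ => 1%N)) /=.
  elim/big_rec: _ => // s m ss em; rewrite oddD em addbF.
  rewrite sum1_card -(@even_doors (lab \o s)); last by move=> sI; apply: none; exists s.
  by congr odd; apply: eq_card => k; rewrite !inE.
have od : odd #|P| = odd #|[set q in P | f q == q]|.
  apply: odd_card_involution => -[s k]; rewrite !inE /= => /andP[ss dk].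
    rewrite flip_simplex //=; apply/doorP => j /(doorP _ _ dk)[i ik /= <-].
    by exists i; rewrite //= flip_other.
  by rewrite /f /= flipK.
suff fixP : [set q in P | f q == q] = [set (corner, (i0 + 1)%R)].
  by move: ev; rewrite od fixP cards1.
apply/finset.setP => -[s k]; rewrite !inE /=; apply/idP/eqP => [|[-> ->]].
  case/andP => /andP[ss dk] /eqP[/eqP].
  have [fk|nfk _] := boolP (flippable s k); first by rewrite (negbTE (flip_neq ss fk)).
  have [pi sp [ms os]] := simplexP ss.
  have st a : s (k + 1)%R a + delta (pi k) a = s k a + delta (pi k + 1)%R a.
    by have /stepP := sp k.
  have st1 a : s k a + delta (pi (k - 1)%R) a = s (k - 1)%R a + delta (pi (k - 1) + 1)%R a.
    by have /stepP/(_ a) := sp (k - 1)%R; rewrite subrK.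
  (* A coordinate that blocks the reflection must be raised by the move into [k], lowered by the
     move out of it, and vanish at both neighbours. *)
  have [b lt_b] : exists b, s (k - 1)%R b + s (k + 1)%R b < s k b.
    by case/forallPn: nfk => b; rewrite -ltnNge; exists b.
  have eb : b = pi k.
    apply/eqP; apply: contraT => ne; have := st b; rewrite {1}/delta (negbTE ne); lia.
  have eb1 : b = (pi (k - 1) + 1)%R.
    apply/eqP; apply: contraT => ne; have := st1 b; rewrite {2}/delta (negbTE ne); lia.
  have sk1 : s (k + 1)%R b = 0 :> nat.
    have := st1 b; have := st b; rewrite -eb1 -eb /delta eqxx succ_neq; lia.
  (* Only the move into [k] raises [b], so [b] stays 0 from [k + 1] round to [k - 1]: the door lies
     in the face x_b = 0. *)
  have s0 r : (r <= p)%N -> s (shift (k + 1)%R r) b = 0 :> nat.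
    elim: r => [_|r IH rp]; first by rewrite shift0.
    have /stepP/(_ b) := sp (shift (k + 1)%R r); rewrite -shiftS IH ?(ltnW rp) //.
    suff e : (b == (pi (shift (k + 1)%R r) + 1)%R) = false.
      by rewrite [delta (_ + 1)%R _]/delta e => /eqP; rewrite addn_eq0 => /andP[/eqP].
    apply/eqP; rewrite {1}eb1 => /addIr/perm_inj/(congr1 (fun x => x + 1)%R).
    rewrite subrK -shiftS => e.
    have : shift k 0 = shift k r.+2.
      by rewrite shift0 {1}e /shift -addrA -[in RHS]natr1 [(1 + _)%R]addrC.
    by move/shift_inj => h; have := h isT; rewrite !ltnS => /(_ rp).
  have s0' i : i != k -> s i b = 0 :> nat.
    have [r ltr ->] := shiftP (k + 1)%R i => ne; apply: s0.
    move: ltr; rewrite !ltnS leq_eqVlt => /orP[/eqP e|//].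
    move: ne; rewrite e /shift -addrA [(1 + _)%R]addrC natr1.
    by rewrite -[X in (_ + X)%R]/(p.+2%:R)%R (_ : p.+2%:R = 0 :> idx)%R ?addr0 ?eqxx //; apply: val_inj; rewrite Zp_nat; exact: modnn.
  (* Otherwise [b] would occur as a label on the door, at a vertex where coordinate [b] vanishes. *)
  have bl : b = last.
    apply/eqP; apply: contraT => /(doorP _ _ dk)[i ik /= li].
    by have := lab_gt0 (ms i); rewrite li s0'.
  (* At the vertex labelled [q0], the coordinates below [q0] vanish by [lab_face] and [last]
     vanishes too: it is N e_q0. *)
  have [i ik /= li] := doorP _ _ dk _ (negbT q0_neq).
  have sl : s i last = 0 :> nat by rewrite -bl s0'.
  have sn a : a != q0 -> s i a = 0 :> nat.
    move=> aq; have [->//|al] := eqVneq a last.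
    apply: (lab_face (ms i) sl); rewrite li ltn_neqAle; apply/andP; split; first exact: aq.
    rewrite val_q0 -ltnS ltn_neqAle -ltnS ltn_ord andbT.
    exact: al.
  have sq : s i q0 = N :> nat.
    by have := ms i; rewrite /mass (bigD1 q0) //= big1 ?addn0.
  have [ii ->] := corner_uniq ss sq sn; rewrite -ii; congr (_, _).
  apply/eqP; apply: contraT; rewrite eq_sym => /s0'.
  have /stepP/(_ b) := sp i.
  have ei : pi i = q0.
    apply/eqP; apply: contraT => ne; have /stepP/(_ (pi i)) := sp i.
    by rewrite (sn _ ne) /delta eqxx succ_neq addn1.
  by rewrite ei q0S bl sl /delta eqxx (eq_sym last) q0_neq addn0 => ->.
(* Around vertex [i0 + 1] the coordinate [last] takes the values 0, 1, 0. *)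
have nfl : ~~ flippable corner (i0 + 1)%R.
  apply/forallPn; exists last; rewrite addrK -ltnNge.
  have := cornerE i0 last; have := cornerE (i0 + 1)%R last; have := cornerE (i0 + 1 + 1)%R last.
  rewrite subrr addr0 (addrC i0) addrK (addrC 1%R i0) -(addrA i0) (addrC i0) addrK addrA q0S last_succ.
  rewrite /delta eqxx (eq_sym last q0) q0_neq (_ : (last == 0%R) = false) //.
  by lia.
rewrite /f /= /flip (negbTE nfl) eqxx andbT corner_simplex /=.
have [pi sp [ms os]] := simplexP corner_simplex.
(* This vertex is (N - 1) e_q0 + e_j. Its first positive coordinate is [j], because j <= q0, so its
   label is [j]. *)
apply/doorP => j jl; pose i := (i0 + (j - q0))%R; exists i.
  apply: contra jl => /eqP/addrI/eqP; rewrite subr_eq addrC q0S.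
  by move=> /eqP ->.
have cE a : corner i a + delta q0 a = N * delta q0 a + delta j a.
  have e : (q0 + (i - i0))%R = j by rewrite /i [(i0 + _)%R]addrC addrK addrC subrK.
  by have := cornerE i a; rewrite e.
have c0 : corner i last = 0 :> nat.
  have := cE last; rewrite /delta (eq_sym last q0) q0_neq (eq_sym last) (negbTE jl); lia.
have lf := lab_face (ms i) c0; have lp := lab_gt0 (ms i).
rewrite /=; apply/eqP; apply: contraT => nj.
have := cE (lab (corner i)); rewrite {3}/delta (negbTE nj) /delta.
have [e _|_] := eqVneq (lab (corner i)) q0; last by lia.
have jq : (j < q0)%N.
  rewrite ltn_neqAle; apply/andP; split.
    by apply: contra nj => /eqP/val_inj ->; rewrite e.
  rewrite val_q0 -ltnS ltn_neqAle -ltnS ltn_ord andbT.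
  exact: jl.
have := lf j; rewrite e => /(_ jq); have := cE j.
by rewrite /delta eqxx; case: eqP => [ej|_]; [move: jq; rewrite ej ltnn | lia].
Qed.

End Sperner.

(** * The Gale / Simmons-Su theorem *)

Local Open Scope classical_set_scope.

Definition in_simplex (R : realType) n (t : 'I_n -> R) :=
  (forall a, 0 <= t a) /\ \sum_a t a = 1.

Lemma cvg_subseq (R : realType) (u : R^nat) (l : R) (f : nat -> nat) :
  increasing_seq f -> u @ \oo --> l -> (u \o f) @ \oo --> l.
Proof.
move=> fi ul; apply: (cvg_comp f u _ ul).
by apply/cvgnyPge => A; exists A => // k /= Ak; apply: leq_trans Ak _;
  elim: k => // k IH; apply: leq_ltn_trans IH _; have := leqW_mono fi k k.+1; rewrite ltnSn => ->.
Qed.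

Lemma bolzano_weierstrass_ord (R : realType) n (u : nat -> 'I_n -> R) (M : R) :
  (forall k a, `|u k a| <= M) ->
  exists (f : nat -> nat) (t : 'I_n -> R),
    increasing_seq f /\ forall a, (fun k => u (f k) a) @ \oo --> t a.
Proof.
move=> uM.
suff: forall s : seq 'I_n, exists (f : nat -> nat) (t : 'I_n -> R),
    increasing_seq f /\ forall a, a \in s -> (fun k => u (f k) a) @ \oo --> t a.
  by move=> /(_ (enum 'I_n))[f [t [fi ft]]]; exists f, t; split=> // a; apply: ft; rewrite mem_enum.
elim=> [|b s [f [t [fi ft]]]]; first by exists id, (fun=> 0).
have bnd : bounded_fun (fun k => u (f k) b).
  by exists M; split; [exact: num_real | move=> x Mx k _ /=; apply: le_trans (uM _ _) (ltW Mx)].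
have [g gi /cvg_ex[/= l gl]] := bolzano_weierstrass bnd.
exists (f \o g), (fun a => if a == b then l else t a); split.
  by move=> x y /=; rewrite fi; exact: gi.
move=> a; rewrite inE; have [->//|_ /= as_] := eqVneq a b.
exact: cvg_subseq gi (ft a as_).
Qed.

Section Gale.
Variables (R : realType) (p : nat).
Local Notation idx := 'I_p.+2.
Local Notation last := (ord_max : idx).
Variable F : idx -> idx -> (idx -> R) -> R.
Hypothesis F_face : forall i j t, in_simplex t -> t j = 0 -> exists k, F i j t < F i k t.

Let fav i t : idx := [arg max_(j > ord0) F i j t]%O.

Let favP i t j : F i j t <= F i (fav i t) t.
Proof. by rewrite /fav; case: Order.TotalTheory.arg_maxP => // k _; apply. Qed.

Let fav_gt0 i t : in_simplex t -> 0 < t (fav i t).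
Proof.
move=> st; rewrite lt_neqAle (st.1 _) andbT; apply/eqP => /esym /(F_face i st)[k].
by rewrite ltNge favP.
Qed.

(* The grid has total N + 2 instead of N + 1: the face x_last = 0 is an additional
   layer that carries the labels required by [lab_face]. *)
Lemma approx_envy_free (N : nat) : exists (pi : {perm idx}) (u : idx -> idx -> R),
  [/\ forall i, in_simplex (u i), forall i k a, u i a <= u k a + N.+1%:R^-1
    & forall i j, F i j (u i) <= F i (pi i) (u i)].
Proof.
pose vertex := {ffun idx -> 'I_N.+3}.
pose point (x : vertex) (a : idx) : R := ((x a)%:R - (a == last)%:R) / N.+1%:R.
(* On the extra layer the label is the first positive coordinate. The [pick] only supplies the
   candidate that [arg_min] requires; its default [ord0] is reached only at mass 0. *)
pose lab (x : vertex) : idx := if x last == 0 :> nat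
  then [arg min_(a < odflt ord0 [pick a | (0 < x a)%N] | (0 < x a)%N) (a : nat)]
  else fav (owner x) (point x).
have N0 : (0 : R) < N.+1%:R by rewrite ltr0n.
have pointS x : mass x = N.+2 -> (0 < x last)%N -> in_simplex (point x).
  move=> mx x0; split=> [a|].
    rewrite divr_ge0 ?ler0n // subr_ge0 ler_nat.
    by case: eqP => [->|_]; [rewrite -ltnS in x0 * | ].
  rewrite -mulr_suml sumrB -!natr_sum -/(mass x) mx (bigD1 last) //= eqxx big1.
    by rewrite addn0 -natrB // subn1 divff // gt_eqF.
  by move=> a /negbTE ->.
have minlab x : mass x = N.+2 -> x last = 0%N :> nat ->
    (0 < x (lab x))%N /\ forall j : idx, (j < lab x)%N -> x j = 0%N :> nat.
  move=> mx x0; rewrite /lab x0 eqxx.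
  case: arg_minnP => [|a xa amin].
    case: pickP => [//|/= none].
    have : mass x = 0%N by rewrite /mass big1 // => a _; have := none a; rewrite lt0n => /negbFE/eqP.
    by rewrite mx.
  split=> // j ja; apply/eqP; rewrite -leqn0 leqNgt; apply/negP => /amin.
  by rewrite leqNgt ja.
have favlab x : mass x = N.+2 -> (0 < x last)%N ->
    [/\ lab x = fav (owner x) (point x), (0 < x (lab x))%N & lab x = last -> (1 < x last)%N].
  move=> mx x0; have e : lab x = fav (owner x) (point x) by rewrite /lab -[_ == _]negbK -lt0n x0.
  have := fav_gt0 (owner x) (pointS x mx x0); rewrite -e /point pmulr_lgt0 ?invr_gt0 // subr_gt0 ltr_nat.
  split=> // [|el]; first by apply: leq_ltn_trans H.
  by move: H; rewrite el eqxx.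
have lab0 x : mass x = N.+2 -> (0 < x (lab x))%N.
  by move=> mx; have [/(minlab x mx)[]|/(favlab x mx)[]] := posnP (x last).
have labf x : mass x = N.+2 -> x last = 0%N :> nat ->
    forall j : idx, (j < lab x)%N -> x j = 0%N :> nat.
  by move=> mx x0; case: (minlab x mx x0).
have [s ss sI] := sperner lab0 (ltn0Sn _) labf.
have [_ _ [ms os]] := simplexP ss.
have [g _ gK] := injF_bij sI.
(* The label [last] occurs only where x_last > 1, and coordinates differ by at most 1 within a
   simplex, so no vertex of this simplex is on the extra layer. *)
have sl : (1 < s (g last) last)%N.
  have e : lab (s (g last)) = last := gK last.
  have : (0 < s (g last) last)%N by have := lab0 _ (ms (g last)); rewrite e.
  by case/(favlab _ (ms _)) => _ _; apply.
have sl1 i : (0 < s i last)%N.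
  by have := simplex_close (g last) i last ss; lia.
exists (perm sI), (fun i => point (s i)); split=> [i|i k a|i j].
- exact: pointS.
- rewrite /point -[X in _ <= _ + X]div1r -[leRHS]mulrDl ler_pM2r ?invr_gt0 //.
  rewrite addrAC lerD2r natr1 ler_nat.
  by have := simplex_close i k a ss; rewrite addn1.
- rewrite permE /=; have [-> _ _] := favlab _ (ms i) (sl1 i).
  by rewrite os favP.
Qed.

Hypothesis F_cvg : forall i j (u : nat -> idx -> R) t,
  (forall k, in_simplex (u k)) -> in_simplex t ->
  (forall a, (fun k => u k a) @ \oo --> t a) -> (fun k => F i j (u k)) @ \oo --> F i j t.

(** Vertices of ever finer simplices accumulate at one point t. If each of the finitely many
    permutations failed at t, by a strict inequality, continuity would make them all fail far along
    the sequence, including the one that [approx_envy_free] provides there. *)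
Lemma gale : exists2 t, in_simplex t &
  exists pi : {perm idx}, forall i j, F i j t <= F i (pi i) t.
Proof.
have [pi /choice[u]] := choice approx_envy_free.
move=> /all_and3[us uc ub].
have u01 k i a : 0 <= u k i a <= 1.
  rewrite (us k i).1 -(us k i).2 (bigD1 a) //= lerDl sumr_ge0 // => b _.
  exact: (us k i).1.
have [|f [t [fi ft]]] := @bolzano_weierstrass_ord R _ (fun k => u k ord0) 1.
  by move=> k a; have /andP[? ?] := u01 k ord0 a; rewrite ger0_norm.
have f_ge k : (k <= f k)%N.
  elim: k => // k IH; apply: leq_ltn_trans IH _.
  by have := leqW_mono fi k k.+1; rewrite ltnSn => ->.
have ut i a : (fun k => u (f k) i a) @ \oo --> t a.
  have inv0 : (fun k : nat => k.+1%:R^-1 : R) @ \oo --> 0 by exact: cvg_harmonic.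
  have fk (k : nat) : (f k).+1%:R^-1 <= k.+1%:R^-1 :> R.
    by rewrite lef_pV2 ?posrE ?ltr0n // ler_nat ltnS f_ge.
  apply: (@squeeze_cvgr _ _ _ _ (fun k => u (f k) ord0 a - k.+1%:R^-1)
            (fun k => u (f k) ord0 a + k.+1%:R^-1)).
  - apply: nearW => k.
    have := uc (f k) ord0 i a; have := uc (f k) i ord0 a; have := fk k.
    move: ((f k).+1%:R^-1) (k.+1%:R^-1) => y z h1 h2 h3.
    by apply/andP; split; lra.
  - by rewrite -[t a]subr0; apply: cvgB (ft a) inv0.
  - by rewrite -[t a]addr0; apply: cvgD (ft a) inv0.
have ts : in_simplex t.
  split=> [a|].
    apply: (cvgr_to_ge (ft a)).
    by apply: nearW => k; case/andP: (u01 (f k) ord0 a).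
  have h1 : (fun k => \sum_a u (f k) ord0 a) @ \oo --> \sum_a t a.
    elim: (index_enum _) => [|a s IH].
      by rewrite big_nil; under eq_fun do rewrite big_nil; exact: cvg_cst.
    by rewrite big_cons; under eq_fun do rewrite big_cons; exact: cvgD (ft a) IH.
  have h2 : (fun k => \sum_a u (f k) ord0 a) @ \oo --> (1 : R).
    by under eq_fun do rewrite (us _ _).2; exact: cvg_cst.
  exact: (@cvg_unique _ (@Rhausdorff R) _ _ _ _ h1 h2).
exists t => //; apply: contrapT => nopi.
have : \forall k \near \oo, forall q : {perm idx}, pi (f k) <> q.
  apply: filter_forall => q.
  have [i [j lt_ij]] : exists i j, F i (q i) t < F i j t.
    apply: contrapT => none; apply: nopi; exists q => i j; rewrite leNgt; apply/negP => lt_ij.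
    by apply: none; exists i, j.
  have cv j' := @F_cvg i j' _ _ (fun k => us (f k) i) ts (ut i).
  have : (fun k => F i j (u (f k) i) - F i (q i) (u (f k) i)) @ \oo --> F i j t - F i (q i) t.
    exact: cvgB (cv j) (cv (q i)).
  move=> /cvgr_gt /(_ 0); rewrite subr_gt0 => /(_ lt_ij); apply: filterS => k.
  by rewrite subr_gt0 => lt_k e; have := ub (f k) i j; rewrite e leNgt lt_k.
by move=> /filter_ex[k /(_ (pi (f k)))].
Qed.

End Gale.

(** * The iterated integral as an integral against a measure *)

Section ConsMeasure.
Variables (R : realType) (d : nat) (mu : {sigma_finite_measure set (d.-tuple R) -> \bar R}).

Definition cons_pair (z : R * d.-tuple R) : d.+1.-tuple R := [tuple of z.1 :: z.2].

Lemma measurable_cons_pair : measurable_fun setT cons_pair.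
Proof. exact: measurable_cons measurable_fst measurable_snd. Qed.

(** Integrating against it puts one more Lebesgue integral in front. Sigma-finiteness is carried
    along because Tonelli asks for it again in the next dimension. *)
Definition cons_measure : set (d.+1.-tuple R) -> \bar R :=
  pushforward (@lebesgue_measure R \x mu)%E cons_pair.

Let cm0 : cons_measure set0 = 0%E.
Proof. by rewrite /cons_measure /pushforward preimage_set0 measure0. Qed.

Let cm_ge0 A : (0 <= cons_measure A)%E.
Proof. by rewrite /cons_measure /pushforward measure_ge0. Qed.

Let cm_sigma_additive : semi_sigma_additive cons_measure.
Proof.
move=> F mF tF mUF; rewrite /cons_measure /pushforward preimage_bigcup.
have mc A : measurable A -> measurable (cons_pair @^-1` A).
  by move=> mA; rewrite -[X in measurable X]setTI; exact: measurable_cons_pair.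
apply: measure_semi_sigma_additive.
- by move=> n; exact: mc.
- apply/trivIsetP => /= i j _ _ ij; rewrite -preimage_setI.
  by move/trivIsetP : tF => /(_ _ _ _ _ ij) ->//; rewrite preimage_set0.
- by rewrite -preimage_bigcup; exact: mc.
Qed.

HB.instance Definition _ := isMeasure.Build _ _ _ cons_measure cm0 cm_ge0 cm_sigma_additive.

Let cm_sigma_finite : sigma_finite setT cons_measure.
Proof.
have /sigma_finiteP[F [TF ndF Foo]] := sigma_finiteT (@lebesgue_measure R).
have /sigma_finiteP[G [TG ndG Goo]] := sigma_finiteT mu.
pose unc (t : d.+1.-tuple R) := (thead t, [tuple of behead t]).
have uncK z : unc (cons_pair z) = z.
  by case: z => x t; rewrite /unc /cons_pair theadE; congr (_, _); exact: val_inj.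
have munc : measurable_fun setT unc.
  apply/measurable_fun_prod; first exact: measurable_tnth.
  exact: measurable_behead.
exists (fun k => unc @^-1` (F k `*` G k)).
  apply/esym/seteqP; split=> // t _.
  have [n _ Fn] : (\bigcup_i F i) (thead t) by rewrite -TF.
  have [k _ Gk] : (\bigcup_i G i) [tuple of behead t] by rewrite -TG.
  exists (maxn n k) => //; split.
    by have /subsetPset sF := ndF _ _ (leq_maxl n k); exact: sF.
  by have /subsetPset sG := ndG _ _ (leq_maxr n k); exact: sG.
move=> k; have [mF Fk] := Foo k; have [mG Gk] := Goo k.
have mFG : measurable (F k `*` G k) by exact: measurableX.
split; first by rewrite -[X in measurable X]setTI; exact: munc.
rewrite /cons_measure /pushforward (_ : _ @^-1` _ = F k `*` G k).
  by rewrite product_measure1E // lte_mul_pinfty // ge0_fin_numE.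
by apply/funext => z; rewrite -[in RHS](uncK z).
Qed.

HB.instance Definition _ := Measure_isSigmaFinite.Build _ _ _ cons_measure cm_sigma_finite.

Lemma integral_cons_measure (f : d.+1.-tuple R -> \bar R) :
  measurable_fun [set: d.+1.-tuple R] f -> (forall x, (0 <= f x)%E) ->
  (\int[cons_measure]_x f x =
   \int[@lebesgue_measure R]_x \int[mu]_t f [tuple of x :: t])%E.
Proof.
move=> mf f0; rewrite /cons_measure ge0_integral_pushforward //; last exact: measurable_cons_pair.
rewrite preimage_setT fubini_tonelli1 //.
  exact: measurableT_comp mf measurable_cons_pair.
by move=> x; exact: f0.
Qed.

End ConsMeasure.

Lemma iint_measure (R : realType) d :
  exists mu : {sigma_finite_measure set (d.-tuple R) -> \bar R},
    forall f : d.-tuple R -> \bar R, measurable_fun [set: d.-tuple R] f -> (forall x, (0 <= f x)%E) ->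
    iint f = (\int[mu]_x f x)%E.
Proof.
elim: d => [|d [mu mu_iint]].
  exists (\d_([tuple] : 0.-tuple R))%E => f mf f0 /=.
  by rewrite integral_dirac // diracT mul1e.
exists (cons_measure mu) => f mf f0 /=.
rewrite integral_cons_measure //; apply: eq_integral => x _.
rewrite mu_iint //; apply: (measurableT_comp mf).
apply: (measurable_cons (f := fun=> x) (g := id)); first exact: measurable_cst.
exact: measurable_id.
Qed.

Lemma iint0 (R : realType) d : iint (fun _ : d.-tuple R => 0%E) = 0%E :> \bar R.
Proof.
elim: d => [|d IH] //=.
by rewrite integral0_eq // => x _; exact: IH.
Qed.

(** * Hyperplanes and boxes under the iterated integral *)

Definition linform (R : realType) d (q : 'I_d -> R) (x : d.-tuple R) : R :=
  \sum_i q i * tnth x i.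

Lemma measurable_linform (R : realType) d (q : 'I_d -> R) :
  measurable_fun [set: d.-tuple R] (linform q).
Proof.
apply: measurable_sum => i; apply: measurable_funM; first exact: measurable_cst.
exact: measurable_tnth.
Qed.

Lemma linform_cons (R : realType) d (q : 'I_d.+1 -> R) x (t : d.-tuple R) :
  linform q [tuple of x :: t] = q ord0 * x + linform (q \o lift ord0) t.
Proof.
rewrite /linform big_ord_recl tnth0; congr (_ + _).
by apply: eq_bigr => i _; rewrite tnthS.
Qed.

(** Slice along the first coordinate. If a later coefficient is nonzero, every slice is a hyperplane
    again; otherwise all slices are empty except the one over the single point [c / q ord0]. *)
Lemma iint_hyperplane (R : realType) d (q : 'I_d -> R) (c : R) :
  (exists i, q i != 0) ->
  iint (fun x => (\1_[set x | linform q x = c] x)%:E : \bar R) = 0%E.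
Proof.
elim: d q c => [|d IH] q c [i qi]; first by case: i qi.
rewrite /=.
have E (x : R) (t : d.-tuple R) : \1_[set x | linform q x = c] [tuple of x :: t] =
    \1_[set t | linform (q \o lift ord0) t = c - q ord0 * x] t :> R.
  rewrite !indicE; congr (nat_of_bool _)%:R; apply/idP/idP; rewrite !inE /= linform_cons.
    by move=> <-; rewrite addrAC subrr add0r.
  by move=> ->; rewrite addrC subrK.
under eq_integral do under [X in iint X]eq_fun do rewrite E.
have [[j qj]|tail0] := pselect (exists j, (q \o lift ord0) j != 0).
  by rewrite integral0_eq // => x _; apply: IH; exists j.
have lin0 t : linform (q \o lift ord0) t = 0.
  rewrite /linform big1 // => j _; have [->|qj] := eqVneq ((q \o lift ord0) j) 0.
    by rewrite mul0r.
  by case: tail0; exists j.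
have q0 : q ord0 != 0.
  case: (unliftP ord0 i) qi => [j ->|-> //] qj.
  by case: tail0; exists j.
rewrite -[RHS](integral_set1 (fun x => iint (fun t : d.-tuple R =>
  (\1_[set t | linform (q \o lift ord0) t = c - q ord0 * x] t)%:E)) (c / q ord0)).
rewrite [RHS]integral_mkcond; apply: eq_integral => x _; rewrite patchE.
case: ifPn => //; rewrite notin_setE /= => xc.
rewrite (_ : (fun _ => _) = fun=> 0%E) ?iint0 //; apply/funext => t.
rewrite indicE memNset //= lin0 => /eqP.
rewrite eq_sym subr_eq0 => /eqP e; apply: xc.
by rewrite e mulrC mulKf.
Qed.

Lemma iint_box (R : realType) d (c : 'I_d -> R) (e : R) : 0 < e ->
  iint (fun x => (\1_[set x : d.-tuple R | forall i, `|tnth x i - c i| <= e] x)%:E) =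
  ((e *+ 2) ^+ d)%:E.
Proof.
move=> e0; elim: d c => [|d IH] c /=.
  by rewrite indicE mem_set //= => -[].
have E (x : R) (t : d.-tuple R) : (\1_[set x : d.+1.-tuple R | forall i, `|tnth x i - c i| <= e] [tuple of x :: t] =
    \1_(`[c ord0 - e, c ord0 + e]) x *
    \1_[set t : d.-tuple R | forall i, `|tnth t i - (c \o lift ord0) i| <= e] t :> R).
  rewrite !indicE -natrM mulnb; congr (nat_of_bool _)%:R.
  apply/idP/andP; rewrite !inE /= in_itv /= => h; last first.
    case: h => h0 h i.
    case: (unliftP ord0 i) => [j|] ->; first by rewrite tnthS; exact: h.
    by rewrite tnth0 ler_distl.
  split; first by have := h ord0; rewrite tnth0 ler_distl.
  by move=> i; have := h (lift ord0 i); rewrite tnthS.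
under eq_integral do under [X in iint X]eq_fun do rewrite E.
transitivity (\int[@lebesgue_measure R]_x
    (((e *+ 2) ^+ d)%:E * (\1_(`[c ord0 - e, c ord0 + e]) x)%:E))%E.
  apply: eq_integral => x _; rewrite -(IH (c \o lift ord0)).
  have [->|->] : \1_(`[c ord0 - e, c ord0 + e]) x = 1 :> R \/ \1_(`[c ord0 - e, c ord0 + e]) x = 0 :> R.
  - by rewrite indicE; case: (x \in _); [left | right].
  - by rewrite mule1; congr iint; apply/funext => t; rewrite mul1r.
  - by rewrite mule0 -[RHS](iint0 R d); congr iint; apply/funext => t; rewrite mul0r.
rewrite ge0_integralZl_EFin //; last 2 first.
- exact/measurable_EFinP/measurable_indic.
- by rewrite exprn_ge0 // mulrn_wge0 // ltW.
rewrite integral_indic // setIT exprSr EFinM; congr (_ * _)%E.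
have := lebesgue_measure_itv (`[c ord0 - e, c ord0 + e])%R; rewrite /= lte_fin.
have -> : c ord0 - e < c ord0 + e by lra.
by move=> ->; rewrite -EFinD mulr2n; congr EFin; lra.
Qed.

Lemma negligible_exists (R : realType) disp (T : measurableType disp)
    (mu : {measure set T -> \bar R}) (I : finType) (N : I -> set T) :
  (forall i, mu.-negligible (N i)) -> mu.-negligible [set x | exists i, N i x].
Proof.
move=> muN; pose M k := if [pick i | enum_rank i == k :> nat] is Some i then N i else set0.
apply: (@negligibleS _ _ _ _ (\bigcup_k M k)).
  move=> x [i Nx]; exists (enum_rank i) => //; rewrite /M.
  case: pickP => [j /eqP /val_inj /enum_rank_inj -> //|/(_ i)].
  by rewrite eqxx.
apply: negligible_bigcup => k; rewrite /M; case: pickP => [i _|_]; first exact: muN.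
exact: negligible_set0.
Qed.

(** * Values as integrals against a measure *)

Section Values.
Variables (R : realType) (d : nat) (mu : {measure set (d.-tuple R) -> \bar R}).
Hypothesis mu_iint : forall f : d.-tuple R -> \bar R,
  measurable_fun [set: d.-tuple R] f -> (forall x, (0 <= f x)%E) ->
  iint f = (\int[mu]_x f x)%E.

Lemma negligible_hyperplane (q : 'I_d -> R) (c : R) :
  (exists i, q i != 0) -> mu.-negligible [set x | linform q x = c].
Proof.
move=> q0; have mH : measurable [set x : d.-tuple R | linform q x = c].
  rewrite (_ : mkset _ = setT `&` linform q @^-1` [set c]); last by rewrite setTI.
  exact: measurable_linform.
apply/negligibleP => //; rewrite -(iint_hyperplane c q0) mu_iint ?integral_indic ?setIT //.
by apply/measurable_EFinP/measurable_indic.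
Qed.

Variable v : d.-tuple R -> R.
Hypothesis mv : measurable_fun [set: d.-tuple R] v.
Hypothesis v_ge0 : forall x, 0 <= v x.

Let mVval X : measurable X ->
  measurable_fun [set: d.-tuple R] (fun x => ((\1_X x : R) * v x)%:E).
Proof.
by move=> mX; apply/measurable_EFinP/measurable_funM => //; exact: measurable_indic.
Qed.

Let Vval_fun_ge0 X x : (0 <= ((\1_X x : R) * v x)%:E)%E.
Proof. by rewrite lee_fin mulr_ge0 // indicE ler0n. Qed.

Lemma Vval_integral X : measurable X ->
  Vval v X = (\int[mu]_x ((\1_X x : R) * v x)%:E)%E.
Proof. by move=> mX; rewrite /Vval mu_iint //; exact: mVval. Qed.

Lemma Vval_ge0 X : measurable X -> (0 <= Vval v X)%E.
Proof. by move=> mX; rewrite Vval_integral // integral_ge0. Qed.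

Lemma Vval_le_sum n (X : 'I_n -> set (d.-tuple R)) Y :
  (forall i, measurable (X i)) -> measurable Y ->
  (forall x, Y x -> exists i, X i x) -> (Vval v Y <= \sum_i Vval v (X i))%E.
Proof.
move=> mX mY YX; rewrite Vval_integral //; under eq_bigr do rewrite Vval_integral //.
rewrite -ge0_integral_sum //; last by move=> i; exact: mVval.
apply: ge0_le_integral => //; first exact: mVval.
- by apply: emeasurable_sum => i; exact: mVval.
- move=> x _; have [Yx|nYx] := pselect (Y x); last first.
    by rewrite indicE memNset // mul0r sume_ge0.
  have [i Xx] := YX x Yx; rewrite (bigD1 i) //= !indicE !mem_set // leeDl //.
  by rewrite sume_ge0.
Qed.

Lemma Vval_sum_le n (X : 'I_n -> set (d.-tuple R)) Y :
  (forall i, measurable (X i)) -> measurable Y ->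
  (forall i j, i != j -> X i `&` X j = set0) -> (forall i, X i `<=` Y) ->
  (\sum_i Vval v (X i) <= Vval v Y)%E.
Proof.
move=> mX mY Xd XY; rewrite Vval_integral //; under eq_bigr do rewrite Vval_integral //.
rewrite -ge0_integral_sum //; last by move=> i; exact: mVval.
apply: ge0_le_integral => //; last 2 first.
- exact: mVval.
- move=> x _; have [[i Xi]|nX] := pselect (exists i, X i x).
    rewrite (bigD1 i) //= big1 ?adde0 => [|j ji].
      by rewrite !indicE !mem_set //; exact: XY Xi.
    rewrite indicE memNset ?mul0r // => Xj.
    by have : (X j `&` X i) x by []; rewrite Xd.
  rewrite big1 // => i _; rewrite indicE memNset ?mul0r // => Xi.
  by apply: nX; exists i.
- by move=> x _; rewrite sume_ge0.
- by apply: emeasurable_sum => i; exact: mVval.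
Qed.

Lemma Vval_mono X Y : measurable X -> measurable Y -> X `<=` Y -> (Vval v X <= Vval v Y)%E.
Proof.
move=> mX mY XY; rewrite !Vval_integral //; apply: ge0_le_integral => //.
- exact: mVval.
- exact: mVval.
- move=> x _; rewrite lee_fin ler_wpM2r // !indicE ler_nat.
  by case: (boolP (x \in X)) => [/set_mem/XY/mem_set ->|].
Qed.

(** Dominated convergence, with the density restricted to [D] as the dominating function. *)
Lemma Vval_cvg (X_ : nat -> set (d.-tuple R)) X D N :
  (forall k, measurable (X_ k)) -> measurable X -> measurable D ->
  (forall k, X_ k `<=` D) -> (Vval v D < +oo)%E -> mu.-negligible N ->
  (forall x, ~ N x -> \forall k \near \oo, X_ k x <-> X x) ->
  (fun k => fine (Vval v (X_ k))) @ \oo --> fine (Vval v X).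
Proof.
move=> mX_ mX mD XD Dfin muN cvX.
have iD : mu.-integrable setT (fun x => ((\1_D x : R) * v x)%:E).
  apply/integrableP; split; first exact: mVval.
  under eq_integral do rewrite gee0_abs //.
  by rewrite -Vval_integral.
have cvf x : ~ N x -> (fun k => ((\1_(X_ k) x : R) * v x)%:E) @ \oo --> ((\1_X x : R) * v x)%:E.
  move=> /cvX nearX; apply: cvg_trans (cvg_cst _ : (fun=> ((\1_X x : R) * v x)%:E) @ \oo --> _).
  apply: near_eq_cvg; apply: filterS nearX => k XX.
  congr (_ * _)%:E; rewrite !indicE; congr (nat_of_bool _)%:R.
  by apply/idP/idP; rewrite !inE => /XX.
have [||iX _ cv] := dominated_convergence (mu := mu) measurableT
    (f_ := fun k x => ((\1_(X_ k) x : R) * v x)%:E) (f := fun x => ((\1_X x : R) * v x)%:E)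
    (fun k => mVval (mX_ k)) (mVval mX) _ iD.
- apply: negligibleS muN => x /= nx; apply: contrapT => /cvf cx; exact: nx.
- apply: aeW => x k _; rewrite gee0_abs // lee_fin ler_wpM2r // !indicE ler_nat.
  by case: (boolP (x \in X_ k)) => [/set_mem/XD/mem_set ->|].
apply: fine_cvg.
rewrite fineK; last by rewrite Vval_integral // integrable_fin_num.
by rewrite Vval_integral //; under eq_fun do rewrite Vval_integral //.
Qed.

End Values.

(** * Simplex-parametrized pieces *)

Section Pieces.
Variables (R : realType) (p d : nat).
Local Notation idx := 'I_p.+2.
Variables (mu : {measure set (d.-tuple R) -> \bar R}).
Hypothesis mu_iint : forall f : d.-tuple R -> \bar R,
  measurable_fun [set: d.-tuple R] f -> (forall x, (0 <= f x)%E) ->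
  iint f = (\int[mu]_x f x)%E.
(** In the application [h j] is the distance to the centre of cell [j] in a norm whose balls are
    cubes, [a] the radius of a scaled cell, [C'] the trimmed cake, and [g] a coordinate that slices
    the remainder. *)
Variables (C C' : set (d.-tuple R)) (h : idx -> d.-tuple R -> R) (g : d.-tuple R -> R) (a : R).
Hypotheses (mC : measurable C) (mC' : measurable C') (C'C : C' `<=` C).
Hypotheses (mh : forall j, measurable_fun [set: d.-tuple R] (h j))
  (mg : measurable_fun [set: d.-tuple R] g).
Hypotheses (h_null : forall j c, mu.-negligible [set x | h j x = c])
  (g_null : forall c, mu.-negligible [set x | g x = c]).
Hypotheses (h_ge0 : forall j x, 0 <= h j x) (a_gt0 : 0 < a).
Hypothesis g01 : forall x, C' x -> 0 <= g x < 1.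
Hypothesis hC : forall j x, h j x <= a -> C x.
Hypothesis h_disj : forall j k x, h j x <= a -> h k x <= a -> j = k.

Let a0 : R := (p.+2%:R *+ 2)^-1.

Let a0_gt0 : 0 < a0.
Proof. by rewrite invr_gt0 pmulrn_lgt0 // ltr0n. Qed.

(* The threshold is 1/(2n) rather than 1/n so that the total excess is never 0. *)
Definition scale (t : idx -> R) j : R := Num.min 1 (t j / a0).

Definition excess (t : idx -> R) j : R := Num.max 0 (t j - a0).

Definition cum (t : idx -> R) (j : nat) : R :=
  (\sum_(k : idx | (k < j)%N) excess t k) / \sum_k excess t k.

Definition core t j : set (d.-tuple R) := [set x | h j x <= scale t j * a].

Definition piece t j : set (d.-tuple R) := core t j `|`
  (C' `&` (\bigcap_k ~` core t k) `&` [set x | cum t j <= g x < cum t j.+1]).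

Let excess_ge0 t j : 0 <= excess t j.
Proof. by rewrite /excess le_max lexx. Qed.

(** The sum of the t_k - a0 is already 1 - n / (2n) = 1/2. *)
Let sum_excess_gt0 t : in_simplex t -> 0 < \sum_k excess t k.
Proof.
move=> [t0 t1]; apply: (@lt_le_trans _ _ (\sum_k (t k - a0))).
  rewrite sumrB t1 sumr_const card_ord -mulr_natr /a0 -(mulr_natr p.+2%:R 2) invfM mulrAC.
  by rewrite mulVf ?pnatr_eq0 // mul1r; lra.
by apply: ler_sum => k _; rewrite /excess le_max lexx orbT.
Qed.

Lemma measurable_core t j : measurable (core t j).
Proof.
rewrite (_ : core t j = setT `&` h j @^-1` `]-oo, scale t j * a]).
  exact: mh.
by apply/seteqP; split=> x; rewrite /core /= in_itv /=; tauto.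
Qed.

Lemma measurable_piece t j : measurable (piece t j).
Proof.
apply: measurableU; first exact: measurable_core.
apply: measurableI; first apply: measurableI => //.
  apply: fin_bigcap_measurable => [|k _]; first exact: finite_finset.
  by apply: measurableC; exact: measurable_core.
rewrite (_ : mkset _ = setT `&` g @^-1` `[cum t j, cum t j.+1[).
  exact: mg.
by apply/seteqP; split=> x; rewrite /= in_itv /=; tauto.
Qed.

Let coreC t j x : core t j x -> h j x <= a.
Proof.
move=> /le_trans; apply; rewrite ler_piMl ?(ltW a_gt0) //.
by rewrite /scale ge_min lexx.
Qed.

Lemma piece_sub t j : piece t j `<=` C.
Proof. by move=> x [/coreC/hC|[[/C'C]]]. Qed.

Let cum_le t (j k : nat) : (j <= k)%N -> cum t j <= cum t k.
Proof.
move=> jk; rewrite /cum ler_wpM2r ?invr_ge0 ?sumr_ge0 //.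
rewrite [leRHS](bigID (fun i : idx => (i < j)%N)) /=.
rewrite [X in _ <= X + _](eq_bigl (fun i : idx => (i < j)%N)).
  by rewrite lerDl sumr_ge0.
by move=> i; case: (ltnP i j) => ij; rewrite ?andbF // (leq_trans ij jk).
Qed.

Lemma piece_disj t j k : j != k -> piece t j `&` piece t k = set0.
Proof.
move=> jk; rewrite -subset0 => x [].
case=> [cj|[[Cj nj] /andP[j1 j2]]]; case=> [ck|[[Ck nk] /andP[k1 k2]]].
- by move: jk; rewrite (h_disj (coreC cj) (coreC ck)) eqxx.
- by have := nk j I; apply.
- by have := nj k I; apply.
- move: jk; rewrite neq_ltn => /orP[lt|lt].
    by have := lt_le_trans j2 (le_trans (cum_le t lt) k1); rewrite ltxx.
  by have := lt_le_trans k2 (le_trans (cum_le t lt) j1); rewrite ltxx.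
Qed.

Lemma piece_cover t x : in_simplex t -> C' x -> exists j, piece t j x.
Proof.
move=> ts Cx; have [[j cj]|nc] := pselect (exists j, core t j x).
  by exists j; left.
have /andP[g0 g1] := g01 Cx.
have c1 : cum t p.+2 = 1.
  rewrite /cum (eq_bigl xpredT) ?divff ?gt_eqF ?sum_excess_gt0 // => i.
  exact: ltn_ord.
have ex : exists j, g x < cum t j by exists p.+2; rewrite c1.
have [j gj jmin] := ex_minnP ex.
case: j gj jmin => [|j] gj jmin.
  by move: gj; rewrite /cum big_pred0 ?mul0r ?ltNge ?g0.
have jp : (j < p.+2)%N by apply: jmin; rewrite c1.
exists (Ordinal jp); right; split; first split=> //.
  by move=> k _ ck; apply: nc; exists k.
by rewrite /= gj andbT leNgt; apply/negP => /jmin; rewrite ltnn.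
Qed.

(** Without excess, [cum t j] equals [cum t j.+1] and the share of the remainder is empty. *)
Lemma piece_small t j : in_simplex t -> t j < a0 -> piece t j = core t j.
Proof.
move=> ts tj; apply/seteqP; split=> x; last by left.
case=> // -[_ /andP[c1 c2]]; have := le_lt_trans c1 c2.
rewrite /cum ltr_pM2r ?invr_gt0 ?sum_excess_gt0 //.
rewrite [X in _ < X](bigD1 j) //= /excess max_l; last by lra.
rewrite add0r [X in _ < X](eq_bigl (fun i : idx => (i < j)%N)) ?ltxx // => i.
by rewrite ltnS -val_eqE /= ltn_neqAle andbC.
Qed.

(** A piece receives a share of the remainder only once its core has full size: a smaller core is a
    cube and fat by itself, but could not absorb remote points. *)
Lemma piece_shape t j : in_simplex t -> 0 < t j ->
  (exists2 s, 0 < s & piece t j = [set x | h j x <= s]) \/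
  ([set x | h j x <= a] `<=` piece t j /\
   piece t j `<=` [set x | h j x <= a] `|` C').
Proof.
move=> ts tj0; have [tj|tj] := ltP (t j) a0.
  left; exists (scale t j * a); last exact: piece_small.
  by rewrite mulr_gt0 // lt_min ltr01 divr_gt0.
right; have s1 : scale t j * a = a.
  by rewrite /scale min_l ?mul1r // ler_pdivlMr ?mul1r.
split=> x; first by move=> hx; left; rewrite /core /= s1.
by case=> [|[[Cx _] _]]; [rewrite /core /= s1; left | right].
Qed.

Let scale_cvg (u : nat -> idx -> R) t j : (fun k => u k j) @ \oo --> t j ->
  (fun k => scale (u k) j) @ \oo --> scale t j.
Proof.
move=> ut.
have c : {for t j, continuous ((fun=> 1) \min (fun y : R^o => y / a0) : R^o -> R^o)}.
  by apply: continuous_min; [exact: cvg_cst | exact: mulrr_continuous].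
exact: (continuous_cvg _ c ut).
Qed.

Let excess_cvg (u : nat -> idx -> R) t j : (fun k => u k j) @ \oo --> t j ->
  (fun k => excess (u k) j) @ \oo --> excess t j.
Proof.
move=> ut.
have c : {for t j, continuous ((fun=> 0) \max (fun y : R^o => y - a0) : R^o -> R^o)}.
  apply: continuous_max; first exact: cvg_cst.
  by apply: cvgB; [exact: cvg_id | exact: cvg_cst].
exact: (continuous_cvg _ c ut).
Qed.

Let sum_excess_cvg (P : pred idx) (u : nat -> idx -> R) t :
  (forall j, (fun k => u k j) @ \oo --> t j) ->
  (fun k => \sum_(j | P j) excess (u k) j) @ \oo --> \sum_(j | P j) excess t j.
Proof.
move=> ut; elim: (index_enum _) => [|j s IH].
  by rewrite big_nil; under eq_fun do rewrite big_nil; exact: cvg_cst.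
rewrite big_cons; under eq_fun do rewrite big_cons.
by case: (P j) => //; apply: cvgD IH; exact: excess_cvg.
Qed.

Let cum_cvg (u : nat -> idx -> R) t j : in_simplex t ->
  (forall j, (fun k => u k j) @ \oo --> t j) ->
  (fun k => cum (u k) j) @ \oo --> cum t j.
Proof.
move=> ts ut; apply: cvgM; first exact: sum_excess_cvg.
apply: cvgV; first by rewrite gt_eqF // sum_excess_gt0.
by have sc := @sum_excess_cvg xpredT _ _ ut; apply: sc.
Qed.

Let near_cmp (y : R^nat) (l c : R) : c <> l -> y @ \oo --> l ->
  \forall k \near \oo, ((c <= y k) = (c <= l)) /\ ((c < y k) = (c < l)).
Proof.
move=> /eqP; rewrite neq_lt => /orP[cl|cl] yl.
  move: yl => /cvgr_gt /(_ _ cl); apply: filterS => k ck.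
  by rewrite ck cl !ltW.
move: yl => /cvgr_lt /(_ _ cl); apply: filterS => k ck.
by rewrite !leNgt ck cl !ltNge !ltW.
Qed.

(** Membership is a finite Boolean combination of comparisons with thresholds continuous in t; away
    from equality each comparison is eventually constant. *)
Lemma piece_near (u : nat -> idx -> R) t (j : idx) x : in_simplex t ->
  (forall j, (fun k => u k j) @ \oo --> t j) ->
  (forall k, h k x <> scale t k * a) -> g x <> cum t j -> g x <> cum t j.+1 ->
  \forall k \near \oo, piece (u k) j x <-> piece t j x.
Proof.
move=> ts ut hx gx1 gx2.
have nh : \forall k \near \oo, forall i : idx, (h i x <= scale (u k) i * a) = (h i x <= scale t i * a).
  apply: filter_forall => i.
  have sc : (fun k => scale (u k) i * a) @ \oo --> scale t i * a.
    by apply: cvgM (cvg_cst a); exact: scale_cvg (ut i).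
  have nc := near_cmp (hx i) sc.
  by apply: filterS nc => k [].
have n1 := near_cmp gx1 (@cum_cvg u t j ts ut); have n2 := near_cmp gx2 (@cum_cvg u t j.+1 ts ut).
apply: filterS3 nh n1 n2 => k e [e1 e1'] [e2 e2'].
have ec i : core (u k) i x = core t i x by rewrite /core /= e.
have eb : (\bigcap_i ~` core (u k) i) x = (\bigcap_i ~` core t i) x.
  apply/propext; split=> H i _; have := H i I; rewrite /setC /mkset; [by rewrite ec | by rewrite -ec].
have eg : (cum (u k) j <= g x < cum (u k) j.+1) = (cum t j <= g x < cum t j.+1).
  by rewrite e2' !(leNgt (cum _ j)) e1'.
by rewrite /piece /setU /setI /mkset ec eb eg.
Qed.

Lemma envy_free_pieces (v : idx -> d.-tuple R -> R) :
  (forall i, measurable_fun [set: d.-tuple R] (v i)) -> (forall i x, 0 <= v i x) ->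
  (forall i, (Vval (v i) C < +oo)%E) -> (forall i, (0 < Vval (v i) C')%E) ->
  exists2 t, in_simplex t & exists pi : {perm idx}, (forall i, 0 < t (pi i)) /\
    forall i j, (Vval (v i) (piece t j) <= Vval (v i) (piece t (pi i)))%E.
Proof.
move=> mv v0 vC vC'; pose F i j t := fine (Vval (v i) (piece t j)).
have Vge0 i j t : (0 <= Vval (v i) (piece t j))%E.
  by apply: (Vval_ge0 mu_iint) => //; exact: measurable_piece.
have Vfin i j t : Vval (v i) (piece t j) \is a fin_num.
  rewrite ge0_fin_numE //; apply: le_lt_trans (vC i).
  by apply: (Vval_mono mu_iint) => //; [exact: measurable_piece | exact: piece_sub].
have Vcvg i j (u : nat -> idx -> R) t : in_simplex t ->
    (forall a, (fun k => u k a) @ \oo --> t a) ->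
    (fun k => F i j (u k)) @ \oo --> F i j t.
  move=> ts ut.
  apply: (Vval_cvg mu_iint (mv i) (v0 i) (D := C)
    (N := [set x | exists k, [set x | h k x = scale t k * a] x] `|`
      ([set x | g x = cum t j] `|` [set x | g x = cum t j.+1]))) => //.
  - by move=> k; exact: measurable_piece.
  - exact: measurable_piece.
  - by move=> k; exact: piece_sub.
  - by apply: negligibleU; [exact: negligible_exists | exact: negligibleU].
  - move=> x nx; apply: piece_near => // [k e|e|e]; apply: nx.
    + by left; exists k.
    + by right; left.
    + by right; right.
have F0 i j t : in_simplex t -> t j = 0 -> F i j t = 0.
  move=> ts tj; rewrite /F piece_small ?tj //.
  have c0 : core t j `<=` [set x | h j x = 0].
    move=> x; rewrite /core /scale /= tj mul0r min_r ?ler01 // mul0r => hx.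
    by apply/eqP; rewrite eq_le hx h_ge0.
  have -> : 0 = fine (Vval (v i) set0) :> R.
    rewrite /Vval (_ : (fun _ => _) = fun=> 0%E) ?iint0 //.
    by apply/funext => x; rewrite indicE memNset // mul0r.
  (* A constant sequence with two limits: its own value, and that of [set0], from which the core
     differs only inside the null set where [h j] is 0. *)
  apply: (@cvg_unique _ (@Rhausdorff R) ((fun _ : nat => fine (Vval (v i) (core t j))) @ \oo)).
    exact: cvg_cst.
  apply: (Vval_cvg mu_iint (mv i) (v0 i) (D := C) (N := [set x | h j x = 0])) => //.
  - by move=> _; exact: measurable_core.
  - by move=> _ x /coreC/hC.
  - by move=> x nx; apply: nearW => _; split=> // /c0.
have Fpos i t : in_simplex t -> exists k, 0 < F i k t.
  move=> ts; apply: contrapT => none; have := vC' i; rewrite ltNge => /negP; apply.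
  have cov x : C' x -> exists j, piece t j x by exact: piece_cover.
  apply: le_trans (Vval_le_sum mu_iint (mv i) (v0 i) _ mC' cov) _.
    by move=> j; exact: measurable_piece.
  apply: sume_le0 => j _; rewrite leNgt; apply/negP => lt; apply: none; exists j.
  by rewrite /F fine_gt0 // lt ltey_eq Vfin.
have face i j t : in_simplex t -> t j = 0 -> exists k, F i j t < F i k t.
  by move=> ts tj; rewrite F0 //; exact: Fpos.
have [t ts [pi pimax]] := gale face (fun i j u t _ => @Vcvg i j u t).
exists t => //; exists pi; split=> [i|i j].
  rewrite lt_neqAle (ts.1 _) andbT; apply/eqP => /esym /(face i _ _ ts)[k].
  by rewrite ltNge pimax.
by have := pimax i j; rewrite /F -lee_fin !fineK.
Qed.

End Pieces.

(** * Rotated coordinates and fat cakes *)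

Section Coordinates.
Variables (R : realType) (d : nat) (Q : 'M[R]_d).
Hypothesis oQ : orthogonal_mx Q.

Definition rcoord i : d.-tuple R -> R := linform (fun j => Q i j).

Lemma rcoord_neq0 i : exists j, Q i j != 0.
Proof.
apply: contrapT => none; have := congr1 (fun A : 'M[R]_d => A i i) oQ.
rewrite !mxE eqxx big1 => [/esym/eqP|j _]; first by rewrite oner_eq0.
have [->|Qj] := eqVneq (Q i j) 0; first by rewrite mul0r.
by case: none; exists j.
Qed.

Lemma rcoord_surj (z : 'I_d -> R) : exists x, forall i, rcoord i x = z i.
Proof.
(* The transpose of [Q] applied to [z]. *)
exists [tuple \sum_k Q k j * z k | j < d] => i; rewrite /rcoord /linform.
under eq_bigr do rewrite tnth_mktuple mulr_sumr; rewrite exchange_big /=.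
under eq_bigr do under eq_bigr do rewrite mulrA; under eq_bigr do rewrite -mulr_suml.
have E k : \sum_j Q i j * Q k j = (i == k)%:R.
  have := congr1 (fun A : 'M[R]_d => A i k) oQ; rewrite !mxE => <-.
  by apply: eq_bigr => j _; rewrite mxE.
under eq_bigr do rewrite E; rewrite (bigD1 i) //= eqxx mul1r big1 ?addr0 // => k ki.
by rewrite eq_sym (negbTE ki) mul0r.
Qed.

Lemma cubeE c l x : cube Q c l x <-> forall i, rcoord i c <= rcoord i x <= rcoord i c + l.
Proof.
have E i : \sum_(j < d) Q i j * (tnth x j - tnth c j) = rcoord i x - rcoord i c.
  by rewrite /rcoord /linform -sumrB; apply: eq_bigr => j _; rewrite mulrBr.
by split=> H i; have := H i; rewrite E subr_ge0 lerBlDl.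
Qed.

Lemma cube_sub c1 c2 l1 l2 : 0 <= l1 -> cube Q c1 l1 `<=` cube Q c2 l2 ->
  forall i, rcoord i c2 <= rcoord i c1 /\ rcoord i c1 + l1 <= rcoord i c2 + l2.
Proof.
move=> l10 sub i.
have in1 : cube Q c1 l1 c1 by apply/cubeE => k; rewrite lexx lerDl.
have [x xE] := rcoord_surj (fun k => rcoord k c1 + l1).
have in2 : cube Q c1 l1 x by apply/cubeE => k; rewrite xE lexx lerDl l10.
have /cubeE/(_ i)/andP[? _] := sub _ in1.
by have /cubeE/(_ i)/andP[_] := sub _ in2; rewrite xE.
Qed.

(** Maximum norm in rotated coordinates: its closed balls are the cubes with axes along the rows of
    [Q]. *)
Definition rdist (z : 'I_d -> R) (x : d.-tuple R) : R :=
  \big[Num.max/0]_i `|rcoord i x - z i|.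

Lemma rdist_le z x c : 0 <= c ->
  (rdist z x <= c) <-> (forall i, `|rcoord i x - z i| <= c).
Proof.
move=> c0; split=> [/bigmax_leP[_ H] i|H]; first exact: H.
by apply/bigmax_leP.
Qed.

Lemma rdist_ge0 z x : 0 <= rdist z x.
Proof. by rewrite /rdist; elim/big_rec: _ => // i y _ y0; rewrite le_max y0 orbT. Qed.

Lemma measurable_rdist z : measurable_fun [set: d.-tuple R] (rdist z).
Proof.
rewrite /rdist; elim: (index_enum _) => [|i s IH].
  by under eq_fun do rewrite big_nil; exact: measurable_cst.
under eq_fun do rewrite big_cons; apply: measurable_maxr => //.
apply: measurableT_comp => //; apply: measurable_funB; last exact: measurable_cst.
exact: measurable_linform.
Qed.

Lemma rdist_attained z x : (0 < d)%N -> exists i, rdist z x = `|rcoord i x - z i|.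
Proof.
move=> d0; have [i _ e] := @Order.TotalTheory.eq_bigmax _ _ _ 0 (Ordinal d0) xpredT
  (fun i => `|rcoord i x - z i|) isT (fun i _ => normr_ge0 _).
by exists i.
Qed.

Variable mu : {measure set (d.-tuple R) -> \bar R}.
Hypothesis mu_iint : forall f : d.-tuple R -> \bar R,
  measurable_fun [set: d.-tuple R] f -> (forall x, (0 <= f x)%E) ->
  iint f = (\int[mu]_x f x)%E.

Lemma negligible_rcoord i c : mu.-negligible [set x | rcoord i x = c].
Proof. by apply: (negligible_hyperplane mu_iint); exact: rcoord_neq0. Qed.

(** The maximum is attained at some coordinate, so a sphere lies in finitely many hyperplanes. *)
Lemma negligible_rdist z c : (0 < d)%N -> mu.-negligible [set x | rdist z x = c].
Proof.
move=> d0; apply: (@negligibleS _ _ _ _ [set x | exists i,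
  ([set x | rcoord i x = z i + c] `|` [set x | rcoord i x = z i - c]) x]).
  move=> x /= <-; have [i ->] := rdist_attained z x d0; exists i.
  by case: (ler0P (rcoord i x - z i)) => _; [right | left]; rewrite /=; ring.
by apply: negligible_exists => i; apply: negligibleU; exact: negligible_rcoord.
Qed.

End Coordinates.

(** * Cells of the inner cube and fatness of the pieces *)

Section FatCake.
Variables (R : realType) (d p m : nat) (Q : 'M[R]_d) (rho : R) (C : set (d.-tuple R))
  (c1 c2 : d.-tuple R) (l1 l2 M : R).
Local Notation idx := 'I_p.+2.
Variable mu : {measure set (d.-tuple R) -> \bar R}.
Hypothesis mu_iint : forall f : d.-tuple R -> \bar R,
  measurable_fun [set: d.-tuple R] f -> (forall x, (0 <= f x)%E) ->
  iint f = (\int[mu]_x f x)%E.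
Hypotheses (oQ : orthogonal_mx Q) (l1_gt0 : 0 < l1) (rho_ge1 : 1 <= rho).
Hypotheses (cube_C : cube Q c1 l1 `<=` C) (C_cube : C `<=` cube Q c2 l2)
  (l2_le : l2 <= rho * l1).
Hypotheses (mC : measurable C) (C_bounded : forall x, C x -> forall i, `|tnth x i| <= M).
Hypotheses (d_gt0 : (0 < d)%N) (n_le : (p.+2 <= m ^ d)%N).

Let m_gt0 : (0 < m)%N.
Proof. by case: m n_le => //; rewrite exp0n. Qed.

Let mR_gt0 : 0 < m%:R :> R.
Proof. by rewrite ltr0n. Qed.

Let cell_card : (p.+2 <= #|{ffun 'I_d -> 'I_m}|)%N.
Proof. by rewrite card_ffun !card_ord. Qed.

Definition cell (j : idx) : {ffun 'I_d -> 'I_m} := enum_val (widen_ord cell_card j).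

Let cell_inj : injective cell.
Proof. by move=> j k /enum_val_inj /(congr1 val) /= e; exact: val_inj. Qed.

Definition center (j : idx) (i : 'I_d) : R :=
  rcoord Q i c1 + ((cell j i)%:R + 2^-1) * (l1 / m%:R).

Let half : R := l1 / m%:R / 2.

Let half_gt0 : 0 < half.
Proof. by rewrite !divr_gt0. Qed.

Let cell_in j i : rcoord Q i c1 <= center j i - half /\
  center j i + half <= rcoord Q i c1 + l1.
Proof.
have e : l1 = m%:R * (half * 2) by rewrite /half divfK // mulrC divfK // gt_eqF.
have le_m : (cell j i)%:R + 1 <= m%:R :> R by rewrite natr1 ler_nat ltn_ord.
have c0 : 0 <= (cell j i)%:R :> R by rewrite ler0n.
have -> : center j i = rcoord Q i c1 + ((cell j i)%:R + 2^-1) * (half * 2).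
  by rewrite /center /half divfK.
rewrite [l1 in X in _ /\ X]e; move: half_gt0 => h0; split; first by nra.
by nra.
Qed.

Let center_in j i : rcoord Q i c2 <= center j i - half /\
  center j i + half <= rcoord Q i c2 + l2.
Proof.
have [h1 h2] := cell_in j i.
have [h3 h4] := cube_sub oQ (ltW l1_gt0) (subset_trans cube_C C_cube) i.
by split; lra.
Qed.

Let center_far j k : j != k -> exists i, half * 2 <= `|center j i - center k i|.
Proof.
move=> jk; have [i ne] : exists i, cell j i != cell k i.
  apply: contrapT => none; move/eqP: jk; apply; apply: cell_inj; apply/ffunP => i.
  by apply/eqP; apply: contraT => ne; case: none; exists i.
exists i.
have -> : center j i - center k i = ((cell j i)%:R - (cell k i)%:R) * (half * 2).
  by rewrite /center /half divfK //; ring.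
rewrite normrM [`|half * 2|]gtr0_norm; last by move: half_gt0; lra.
rewrite ler_peMl //; first by move: half_gt0; lra.
move: ne; rewrite -val_eqE /= neq_ltn => /orP[lt|lt].
  by rewrite distrC ger0_norm ?subr_ge0 ?ler_nat 1?ltnW // lerBrDl natr1 ler_nat.
by rewrite ger0_norm ?subr_ge0 ?ler_nat 1?ltnW // lerBrDl natr1 ler_nat.
Qed.

Section Trimmed.
Variable delta0 : R.
Hypotheses (delta_gt0 : 0 < delta0) (delta_lt1 : delta0 < 1).

(* The points that lie, for every cell, in the image of the outer cube under the
   homothety of ratio delta0 about the centre of that cell: adding such points to the
   scaled cell keeps the ratio of the outer to the inner cube unchanged. *)
Definition trimmed : set (d.-tuple R) := C `&` \bigcap_(ji in [set: idx * 'I_d])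
  [set x | delta0 * (rcoord Q ji.2 c2 - center ji.1 ji.2) <= rcoord Q ji.2 x - center ji.1 ji.2
             <= delta0 * (rcoord Q ji.2 c2 + l2 - center ji.1 ji.2)].

Let rad := delta0 * half.

Let rad_gt0 : 0 < rad.
Proof. exact: mulr_gt0. Qed.

Let rad_lt : rad < half.
Proof. by rewrite gtr_pMl. Qed.

Lemma measurable_trimmed : measurable trimmed.
Proof.
apply: measurableI => //; apply: fin_bigcap_measurable => [|[j i] _ /=].
  exact: finite_finset.
rewrite (_ : mkset _ = setT `&` (fun x => rcoord Q i x - center j i) @^-1`
  `[delta0 * (rcoord Q i c2 - center j i), delta0 * (rcoord Q i c2 + l2 - center j i)]).
  apply: measurable_funB => //; exact: measurable_linform.
by apply/seteqP; split=> x; rewrite /= in_itv /=; tauto.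
Qed.

Let core_C j x : rdist Q (center j) x <= rad -> C x.
Proof.
move=> /(rdist_le _ _ _ (ltW rad_gt0)) H; apply: cube_C; apply/cubeE => i.
have := H i; rewrite ler_norml => /andP[h1 h2].
by have [h3 h4] := cell_in j i; move: rad_lt => h5; apply/andP; split; lra.
Qed.

Let core_disj j k x : rdist Q (center j) x <= rad -> rdist Q (center k) x <= rad -> j = k.
Proof.
move=> /(rdist_le _ _ _ (ltW rad_gt0)) Hj /(rdist_le _ _ _ (ltW rad_gt0)) Hk.
apply/eqP; apply: contraT => /center_far[i].
have := Hj i; have := Hk i; rewrite !ler_norml => /andP[? ?] /andP[? ?].
rewrite leNgt => /negP; case; rewrite ltr_norml; move: rad_lt => ?.
by apply/andP; split; lra.
Qed.

Let fatness_ge1 : 1 <= m%:R * rho.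
Proof. by rewrite -[leLHS]mulr1 ler_pM // ler1n. Qed.

Lemma fat_ball j s : 0 < s -> fat (m%:R * rho) [set x | rdist Q (center j) x <= s].
Proof.
move=> s0; have [c cE] := rcoord_surj oQ (fun i => center j i - s).
have E : [set x | rdist Q (center j) x <= s] = cube Q c (s * 2).
  apply/seteqP; split=> x.
    move=> /(rdist_le _ _ _ (ltW s0)) H; apply/cubeE => i; have := H i.
    by rewrite cE ler_norml => /andP[? ?]; apply/andP; split; lra.
  move=> /cubeE H; apply/(rdist_le _ _ _ (ltW s0)) => i; have := H i.
  by rewrite cE ler_norml => /andP[? ?]; apply/andP; split; lra.
exists Q, c, c, (s * 2), (s * 2); split=> //; rewrite -?E //.
  by rewrite mulr_gt0.
by rewrite ler_peMl // mulr_ge0 // ltW.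
Qed.

(** The outer cube of the piece is the homothetic image of the given outer cube; it contains the
    scaled cell because the given cube contains the cell. The two sides are delta0 l1 / m and delta0
    l2, where l2 <= rho l1. *)
Lemma fat_piece j X : [set x | rdist Q (center j) x <= rad] `<=` X ->
  X `<=` [set x | rdist Q (center j) x <= rad] `|` trimmed -> fat (m%:R * rho) X.
Proof.
move=> sub1 sub2.
have [c cE] := rcoord_surj oQ (fun i => center j i - rad).
have [c' c'E] := rcoord_surj oQ (fun i => center j i + delta0 * (rcoord Q i c2 - center j i)).
exists Q, c, c', (rad * 2), (delta0 * l2); split=> //.
- by rewrite mulr_gt0.
- move=> x /cubeE H; apply: sub1; apply/(rdist_le _ _ _ (ltW rad_gt0)) => i; have := H i.
  by rewrite cE ler_norml => /andP[? ?]; apply/andP; split; lra.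
- move=> x /sub2 [/(rdist_le _ _ _ (ltW rad_gt0)) H|[_ H]]; apply/cubeE => i; rewrite c'E.
    have := H i; rewrite ler_norml /rad => /andP[h1 h2]; have [h3 h4] := center_in j i.
    have h3' : delta0 * (rcoord Q i c2 - center j i) <= delta0 * - half by rewrite ler_pM2l //; lra.
    have h4' : delta0 * half <= delta0 * (rcoord Q i c2 + l2 - center j i) by rewrite ler_pM2l //; lra.
    by apply/andP; split; lra.
  by have := H (j, i) I; rewrite /= => /andP[h1 h2]; apply/andP; split; lra.
- have -> : m%:R * rho * (rad * 2) = delta0 * (rho * l1).
    by rewrite /rad /half; field; rewrite gt_eqF.
  by rewrite ler_pM2l.
Qed.

(** The first coordinate, sent affinely from [-|M|, |M|] into [0, 1); the 1 in the denominator keeps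
    it positive and the upper bound strict. *)
Let slab (x : d.-tuple R) : R := (tnth x (Ordinal d_gt0) + `|M|) / (`|M| *+ 2 + 1).

Let slab_den : 0 < `|M| *+ 2 + 1 :> R.
Proof. by rewrite ltr_wpDl // mulrn_wge0. Qed.

Let measurable_slab : measurable_fun [set: d.-tuple R] slab.
Proof.
apply: measurable_funM; last exact: measurable_cst.
by apply: measurable_funD; [exact: measurable_tnth | exact: measurable_cst].
Qed.

Let slab01 x : C x -> 0 <= slab x < 1.
Proof.
move=> /C_bounded /(_ (Ordinal d_gt0)) /le_trans /(_ (ler_norm M)).
rewrite ler_norml => /andP[h1 h2]; apply/andP; split.
  by apply: divr_ge0; [lra | exact: ltW].
by rewrite ltr_pdivrMr // mul1r mulr2n; lra.
Qed.

Let slab_null c : mu.-negligible [set x | slab x = c].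
Proof.
pose q (j : 'I_d) : R := (j == Ordinal d_gt0)%:R.
apply: (@negligibleS _ _ _ _ [set x | linform q x = c * (`|M| *+ 2 + 1) - `|M|]).
  move=> x /= <-; rewrite /slab divfK ?gt_eqF // addrK.
  rewrite /linform (bigD1 (Ordinal d_gt0)) //= /q eqxx mul1r big1 ?addr0 // => j /negbTE ->.
  by rewrite mul0r.
apply: (negligible_hyperplane mu_iint); exists (Ordinal d_gt0).
by rewrite /q eqxx oner_eq0.
Qed.

Lemma fat_envy_free (v : idx -> d.-tuple R -> R) :
  (forall i, measurable_fun [set: d.-tuple R] (v i)) -> (forall i x, 0 <= v i x) ->
  (forall i, (Vval (v i) C < +oo)%E) -> (forall i, (0 < Vval (v i) trimmed)%E) ->
  exists X : idx -> set (d.-tuple R),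
    [/\ S_allocation C (fat_family (m%:R * rho)) X,
        envy_free (fat_family (m%:R * rho)) v X
      & forall i, (Vval (v i) trimmed <= p.+2%:R%:E * Vval (v i) (X i))%E].
Proof.
move=> mv v0 vC vT.
have trC : trimmed `<=` C by move=> x [].
have hm j := measurable_rdist Q (center j).
have hn j c := negligible_rdist oQ mu_iint (center j) c d_gt0.
have h0 j x := rdist_ge0 Q (center j) x.
have gT x : trimmed x -> 0 <= slab x < 1 by move=> /trC; exact: slab01.
have [t ts [pi [tpos tmax]]] := envy_free_pieces mu_iint mC measurable_trimmed trC hm
  measurable_slab hn slab_null h0 rad_gt0 gT core_C mv v0 vC vT.
pose P j := piece trimmed (fun j => rdist Q (center j)) slab rad t j.
have mP j : measurable (P j) := measurable_piece rad measurable_trimmed hm measurable_slab t j.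
have fP i : fat_family (m%:R * rho) (P (pi i)).
  split=> //; rewrite /P; have [[s s0 ->]|[sub1 sub2]] := piece_shape trimmed (fun j => rdist Q (center j)) slab rad_gt0 ts (tpos i).
    exact: fat_ball.
  exact: fat_piece sub1 sub2.
exists (fun i => P (pi i)); split.
- split=> [i|i j ij|i]; first exact: fP.
    by apply: (piece_disj _ _ rad_gt0 core_disj); rewrite (inj_eq perm_inj).
  exact: (piece_sub trC rad_gt0 core_C).
- move=> i j; apply: (@le_trans _ _ (Vval (v i) (P (pi i)))).
    apply: ge_ereal_sup => _ [s [[ms _] sX] <-].
    apply: le_trans (tmax i (pi j)).
    exact: (Vval_mono mu_iint).
  apply: ereal_sup_ubound; exists (P (pi i)) => //; split=> //; exact: fP.
- move=> i; have cov x : trimmed x -> exists j, P j x by exact: (piece_cover _ _ gT).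
  apply: le_trans (Vval_le_sum mu_iint (mv i) (v0 i) mP measurable_trimmed cov) _.
  apply: (@le_trans _ _ (\sum_(j < p.+2) Vval (v i) (P (pi i)))%E).
    by apply: lee_sum => j _; exact: tmax.
  by rewrite sumr_const card_ord mule_natl.
Qed.

End Trimmed.

(** A point of the cake strictly inside the outer cube passes every trimming inequality once the
    ratio is close to 1; the boundary of that cube lies in finitely many hyperplanes. *)
Lemma trimmed_cvg (v : d.-tuple R -> R) : measurable_fun [set: d.-tuple R] v ->
  (forall x, 0 <= v x) -> (Vval v C < +oo)%E ->
  (fun k => fine (Vval v (trimmed (1 - k.+1%:R^-1)))) @ \oo --> fine (Vval v C).
Proof.
move=> mv v0 vC.
apply: (Vval_cvg mu_iint mv v0 (D := C) (N := [set x | exists i,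
  ([set x | rcoord Q i x = rcoord Q i c2] `|` [set x | rcoord Q i x = rcoord Q i c2 + l2]) x])) => //.
- by move=> k; exact: measurable_trimmed.
- by move=> k x [].
- by apply: negligible_exists => i; apply: negligibleU; exact: negligible_rcoord.
move=> x nx; have [Cx|nCx] := pselect (C x); last by apply: nearW => k; split=> // -[].
have d1 (y : R) : (fun k : nat => (1 - k.+1%:R^-1) * y) @ \oo --> y.
  rewrite -[X in _ --> X]mul1r; apply: cvgM (cvg_cst y).
  rewrite -[X in _ --> X]subr0; apply: cvgB; first exact: cvg_cst.
  exact: cvg_harmonic.
have nearB : \forall k \near \oo, forall ji : idx * 'I_d,
    (1 - k.+1%:R^-1) * (rcoord Q ji.2 c2 - center ji.1 ji.2) < rcoord Q ji.2 x - center ji.1 ji.2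
    /\ rcoord Q ji.2 x - center ji.1 ji.2 < (1 - k.+1%:R^-1) * (rcoord Q ji.2 c2 + l2 - center ji.1 ji.2).
  apply: filter_forall => -[j i] /=.
  have /cubeE/(_ i)/andP[] := C_cube Cx; rewrite !le_eqVlt => /predU1P[e|lt1].
    by case: nx; exists i; left.
  move=> /predU1P[e|lt2]; first by case: nx; exists i; right.
  have n1 : \forall k \near \oo, (1 - k.+1%:R^-1) * (rcoord Q i c2 - center j i) < rcoord Q i x - center j i.
    have dd := d1 (rcoord Q i c2 - center j i).
    by move: dd => /cvgr_lt; apply; rewrite ltrD2r.
  have n2 : \forall k \near \oo, rcoord Q i x - center j i < (1 - k.+1%:R^-1) * (rcoord Q i c2 + l2 - center j i).
    have dd := d1 (rcoord Q i c2 + l2 - center j i).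
    by move: dd => /cvgr_gt; apply; rewrite ltrD2r.
  by apply: filterS2 n1 n2.
apply: filterS nearB => k H; split=> // _; split=> // ji _ /=.
by have [/ltW -> /ltW ->] := H ji.
Qed.

Lemma fat_allocation (v : idx -> d.-tuple R -> R) (e : R) :
  (forall i, measurable_fun [set: d.-tuple R] (v i)) -> (forall i x, 0 <= v i x) ->
  (forall i, (Vval (v i) C < +oo)%E) -> (forall i, (0 < Vval (v i) C)%E) -> 0 < e < 1 ->
  exists X : idx -> set (d.-tuple R),
    [/\ S_allocation C (fat_family (m%:R * rho)) X,
        envy_free (fat_family (m%:R * rho)) v X
      & (((1 - e) / p.+2%:R)%:E <= min_prop C v X)%E].
Proof.
move=> mv v0 vC v_gt0 /andP[e0 e1].
have fin_C i : Vval (v i) C \is a fin_num by rewrite ge0_fin_numE // ltW.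
have C_gt0 i : 0 < fine (Vval (v i) C) by rewrite fine_gt0 // v_gt0 vC.
have nearV : \forall k \near \oo, forall i : idx,
    (1 - e) * fine (Vval (v i) C) < fine (Vval (v i) (trimmed (1 - k.+1%:R^-1))).
  apply: filter_forall => i.
  have := trimmed_cvg (mv i) (v0 i) (vC i); move=> /cvgr_gt; apply.
  by rewrite gtr_pMl //; lra.
(* At k = 0 the ratio would be 0. *)
have near1 : \forall k \near \oo, (0 < k)%N by exists 1%N.
have near2 : \forall k \near \oo, (0 < k)%N /\ forall i : idx,
    (1 - e) * fine (Vval (v i) C) < fine (Vval (v i) (trimmed (1 - k.+1%:R^-1))).
  by apply: filterS2 near1 nearV.
have [k [k0 kV]] := filter_ex near2.
have k01 : 0 < (k.+1%:R^-1 : R) < 1.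
  by rewrite invr_gt0 ltr0n /= invf_lt1 ?ltr0n // ltr1n ltnS.
have {k01 k0} : 0 < 1 - (k.+1%:R^-1 : R) < 1.
  by move: k01; move: (k.+1%:R^-1) => y /andP[y0 y1]; apply/andP; split; lra.
move: (1 - k.+1%:R^-1) kV => delta kV /andP[delta0 delta1].
have T_gt0 i : (0 < Vval (v i) (trimmed delta))%E.
  have : 0 < fine (Vval (v i) (trimmed delta)).
    by apply: lt_trans (kV i); rewrite mulr_gt0 // subr_gt0.
  by case: (Vval _ _) => [r| |] //=; rewrite ltxx.
have [X [SX EX VX]] := fat_envy_free delta0 delta1 mv v0 vC T_gt0.
exists X; split=> //; apply/Order.TotalTheory.bigmin_geP; split; first by rewrite leey.
move=> i _; rewrite lee_fin ler_pdivlMr // mulrAC ler_pdivrMr ?ltr0n //.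
apply: le_trans (ltW (kV i)) _.
have [SXi _ XC] := SX; have [mXi _] := SXi i.
have fin_X : Vval (v i) (X i) \is a fin_num.
  rewrite ge0_fin_numE; last by apply: (Vval_ge0 mu_iint).
  by apply: le_lt_trans (vC i); apply: (Vval_mono mu_iint) => //; exact: XC.
have fin_T : Vval (v i) (trimmed delta) \is a fin_num.
  rewrite ge0_fin_numE; last exact: ltW.
  apply: le_lt_trans (vC i); apply: (Vval_mono mu_iint) => //; first exact: measurable_trimmed.
  by move=> x [].
by rewrite -lee_fin EFinM !fineK // muleC; exact: VX.
Qed.

End FatCake.

(** * The volume density and the theorem *)

Lemma measurable_box (R : realType) d (c : 'I_d -> R) (e : R) :
  measurable [set x : d.-tuple R | forall i, `|tnth x i - c i| <= e].
Proof.
rewrite (_ : mkset _ = \bigcap_(i in [set: 'I_d]) [set x | `|tnth x i - c i| <= e]).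
  apply: fin_bigcap_measurable => [|i _]; first exact: finite_finset.
  rewrite (_ : mkset _ = setT `&` (fun x => `|tnth x i - c i|) @^-1` `]-oo, e]).
    apply: measurableT_comp => //; apply: measurable_funB; last exact: measurable_cst.
    exact: measurable_tnth.
  by apply/seteqP; split=> x; rewrite /= in_itv /=; tauto.
by apply/seteqP; split=> x /= H i; [move=> _; exact: H | exact: H i I].
Qed.

(** Volumes are computed for axis-parallel boxes only. Around the centre of the cube, a rotated
    coordinate moves by at most the row sum of |Q i j| times [e]; the 1 in [S] makes the divisor
    positive outright. *)
Lemma box_in_cube (R : realType) d (Q : 'M[R]_d) (c : d.-tuple R) (l : R) :
  orthogonal_mx Q -> 0 < l -> exists (y : 'I_d -> R) (e : R), 0 < e /\
    [set x : d.-tuple R | forall i, `|tnth x i - y i| <= e] `<=` cube Q c l.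
Proof.
move=> oQ l0; have [y yE] := rcoord_surj oQ (fun i => rcoord Q i c + l / 2).
pose S := 1 + \sum_i \sum_j `|Q i j|.
have S0 : 0 < S by rewrite ltr_pwDl // !sumr_ge0 // => i _; exact: sumr_ge0.
exists (tnth y), (l / 2 / S); split; first by rewrite !divr_gt0.
move=> x xy; apply/cubeE => i.
have : `|rcoord Q i x - rcoord Q i y| <= l / 2.
  rewrite /rcoord /linform -sumrB.
  apply: (@le_trans _ _ (\sum_j `|Q i j| * (l / 2 / S))).
    apply: le_trans (ler_norm_sum _ _ _) _; apply: ler_sum => j _.
    by rewrite -mulrBr normrM ler_wpM2l //; exact: xy.
  rewrite -mulr_suml mulrCA ler_piMr ?divr_ge0 ?(ltW l0) // ler_pdivrMr // mul1r.
  apply: (@le_trans _ _ (\sum_k \sum_j `|Q k j|)); last by rewrite /S lerDr.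
  by rewrite [leRHS](bigD1 i) //= lerDl sumr_ge0 // => k _; exact: sumr_ge0.
by rewrite yE ler_norml => /andP[h1 h2]; apply/andP; split; lra.
Qed.

Lemma Vval_box (R : realType) d (c : 'I_d -> R) (e : R) : 0 < e ->
  Vval (fun=> 1) [set x : d.-tuple R | forall i, `|tnth x i - c i| <= e] = ((e *+ 2) ^+ d)%:E.
Proof. by move=> e0; rewrite /Vval -(iint_box c e0); under eq_fun do rewrite mulr1. Qed.

Lemma volume_density (R : realType) d (C : set (d.-tuple R)) (rho : R) :
  measurable C -> bounded_piece C -> fat rho C -> value_density C (fun=> 1).
Proof.
move=> mC [M CM] [Q [c1 [_ [l1 [_ [oQ l10 sub _ _]]]]]].
have [mu mu_iint] := iint_measure R d.
have m1 : measurable_fun [set: d.-tuple R] (fun=> 1 : R) by exact: measurable_cst.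
split=> //; first by exists 1.
(* The added 1 keeps the half-side positive, as [Vval_box] demands, even for M = 0. *)
- apply: (@le_lt_trans _ _ (Vval (fun=> 1) [set x : d.-tuple R | forall i, `|tnth x i - 0| <= `|M| + 1])).
    apply: (Vval_mono mu_iint) => //; first exact: measurable_box.
    move=> x /CM xM i; rewrite subr0; apply: le_trans (xM i) _.
    by rewrite (le_trans (ler_norm M)) // lerDl.
  by rewrite (Vval_box (fun=> 0)) ?ltry // ltr_wpDl.
- have [y [e [e0 box]]] := box_in_cube c1 oQ l10.
  apply: (@lt_le_trans _ _ (Vval (fun=> 1) [set x : d.-tuple R | forall i, `|tnth x i - y i| <= e])).
    by rewrite Vval_box // lte_fin exprn_gt0 // mulrn_wgt0.
  apply: (Vval_mono mu_iint) => //; first exact: measurable_box.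
  exact: subset_trans box sub.
Qed.

(** Under one common measure the values of disjoint pieces add up to at most that of [C], so they
    cannot all exceed 1/n of it. *)
Lemma min_prop_le (R : realType) d n (C : set (d.-tuple R)) S (v : d.-tuple R -> R)
    (X : 'I_n -> set (d.-tuple R)) : (0 < n)%N -> measurable C -> S `<=` measurable ->
  value_density C v -> S_allocation C S X ->
  (min_prop C (fun=> v) X <= (n%:R^-1)%:E)%E.
Proof.
move=> n0 mC mS [mv v0 _ Cfin C0] [SX dX XC].
have [mu mu_iint] := iint_measure R d.
have mX i : measurable (X i) by apply: mS; exact: SX.
have finC : Vval v C \is a fin_num by rewrite ge0_fin_numE // ltW.
have C_gt0 : 0 < fine (Vval v C) by rewrite fine_gt0 // C0.
have finX i : Vval v (X i) \is a fin_num.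
  rewrite ge0_fin_numE; last exact: (Vval_ge0 mu_iint).
  by apply: le_lt_trans Cfin; exact: (Vval_mono mu_iint).
rewrite leNgt; apply/negP => lt_min.
have lt_i i : n%:R^-1 * fine (Vval v C) < fine (Vval v (X i)).
  rewrite -ltr_pdivlMr // -lte_fin; apply: lt_le_trans lt_min _.
  exact: Order.TotalTheory.bigmin_le.
have : \sum_(i < n) n%:R^-1 * fine (Vval v C) < \sum_(i < n) fine (Vval v (X i)).
  by apply: ltr_sum => //; apply/hasP; exists (Ordinal n0); rewrite ?mem_index_enum.
rewrite sumr_const card_ord -mulrnAl -mulr_natl divff ?pnatr_eq0 -?lt0n // mul1r.
rewrite ltNge -lee_fin -sumEFin fineK //; under eq_bigr do rewrite fineK //.
by move=> /negP; apply; exact: (Vval_sum_le mu_iint).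
Qed.

Theorem theorem2 (R : realType) (d n m : nat) (rho : R)
  (C : set (d.-tuple R)) :
  (2 <= d)%N -> 1 <= rho -> (2 <= n)%N ->
  measurable C -> bounded_piece C -> fat rho C ->
  (n <= m ^ d)%N -> (forall k : nat, (n <= k ^ d)%N -> (m <= k)%N) ->
  PropEF C n (@fat_family R d (m%:R * rho)) = (n%:R^-1)%:E.
Proof.
move=> d2 rho1; case: n => [//|[//|p]] _ mC Cb Cf nm _.
have vol := volume_density mC Cb Cf.
have [M CM] := Cb; have [Q [c1 [c2 [l1 [l2 [oQ l10 sub1 sub2 l12]]]]]] := Cf.
have [mu mu_iint] := iint_measure R d.
apply/eqP; rewrite eq_le; apply/andP; split.
  apply: ereal_inf_le; exists (ereal_sup [set min_prop C (fun _ : 'I_p.+2 => fun=> 1) X | X in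
      [set X | S_allocation C (fat_family (m%:R * rho)) X /\
               envy_free (fat_family (m%:R * rho)) (fun _ : 'I_p.+2 => fun=> 1) X]]).
    by exists (fun _ : 'I_p.+2 => fun=> 1).
  apply: ge_ereal_sup => _ [X [SX _] <-].
  by apply: (min_prop_le _ mC _ vol SX) => // Y [].
apply: le_ereal_inf_tmp => _ [v vD <-].
(* The cap 1/2 provides e' < 1 for [fat_allocation]; the loss e' / n is at most e. *)
apply/lee_addgt0Pr => e e0; pose e' := Num.min e 2^-1.
have e'0 : 0 < e' by rewrite lt_min e0 invr_gt0 ltr0n.
have e'1 : e' < 1 by rewrite gt_min; apply/orP; right; lra.
have e'e : e' <= e by rewrite ge_min lexx.
have [|||||X [SX EX VX]] := fat_allocation mu_iint oQ l10 rho1 sub1 sub2 l12 mC CM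
    (ltnW d2) nm (v := v) (e := e').
- by move=> i; case: (vD i).
- by move=> i; case: (vD i).
- by move=> i; case: (vD i).
- by move=> i; case: (vD i).
- by rewrite e'0.
apply: (@le_trans _ _ (min_prop C v X + e%:E)%E); last first.
  by rewrite leeD2r //; apply: ereal_sup_ubound; exists X.
apply: (@le_trans _ _ (((1 - e') / p.+2%:R)%:E + e%:E)%E); last by rewrite leeD2r.
rewrite -EFinD lee_fin mulrBl mul1r -addrA lerDl addrC subr_ge0.
by apply: le_trans e'e; rewrite ler_piMr ?(ltW e'0) // invf_le1 ?ltr0n // ler1n.
Qed.
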